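(* There is an algorithm that, for a graph $G$ on $n$ vertices with unknown real edge lengths and two vertices $s, t$, finds a minimum-length $s$-$t$ path in $G$ (or a negative cycle, if one exists) using $O(n^3)$ $s$-$t$ walk comparisons and $O(n^3)$ time.
   Context: The length of a walk is the sum of the lengths of its edges, counted with multiplicity. An $s$-$t$ walk comparison takes two $s$-$t$ walks $P, Q$ and reveals whether the length of $P$ is less than, equal to, or greater than the length of $Q$.
   Formalization: A negative cycle must be returned only if some s-t walk meets it (others cannot be detected by s-t walk comparisons); otherwise a minimum-length s-t path may be returned, and if there is no s-t path the algorithm may report that. *)

(* Defs.v *)
From HB Require Import structures.
From mathcomp Require Import all_boot all_order all_algebra.
From mathcomp Require Import reals.
Set Implicit Arguments.
Unset Strict Implicit.
Unset Printing Implicit Defensive.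
Import Order.TTheory GRing.Theory Num.Theory.
Local Open Scope ring_scope.

(* Graphs are directed, on the vertex set 'I_n, given by an arbitrary relation
   e; w u v is the length of the edge (u, v) and is irrelevant when ~~ e u v.
   An undirected graph is the case where e and w are symmetric; an edge of
   negative length is then a negative cycle [:: u; v].
   A walk is the sequence of all its vertices, endpoints included, so the walk
   [:: s] without edges is an s-s walk. *)

Definition st_walk n (e : rel 'I_n) (s t : 'I_n) (p : seq 'I_n) : bool :=
  if p is x :: q then [&& x == s, path e x q & last x q == t] else false.

Definition st_path n (e : rel 'I_n) (s t : 'I_n) (p : seq 'I_n) : bool :=
  st_walk e s t p && uniq p.

Definition walk_length (R : realType) n (w : 'I_n -> 'I_n -> R)
    (p : seq 'I_n) : R :=
  \sum_(a <- zip p (behead p)) w a.1 a.2.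

(* As in the library's cycle predicate, the first vertex is not repeated at the
   end of the sequence; [:: u] is a loop. *)
Definition cycle_length (R : realType) n (w : 'I_n -> 'I_n -> R)
    (c : seq 'I_n) : R :=
  if c is x :: _ then walk_length w (rcons c x) else 0.

Definition negative_cycle (R : realType) n (e : rel 'I_n)
    (w : 'I_n -> 'I_n -> R) (c : seq 'I_n) : Prop :=
  [/\ c != [::], ucycle e c & cycle_length w c < 0].

(* None when one of the arguments is not an s-t walk: such a query is illegal. *)
Definition walk_comparison (R : realType) n (e : rel 'I_n)
    (w : 'I_n -> 'I_n -> R) (s t : 'I_n) (P Q : seq 'I_n) : option comparison :=
  if st_walk e s t P && st_walk e s t Q then
    Some (if walk_length w P < walk_length w Q then Lt
          else if walk_length w P == walk_length w Q then Eq else Gt)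
  else None.

Inductive outcome n :=
  | NoPath
  | ShortestPath of seq 'I_n
  | NegativeCycle of seq 'I_n.
Arguments NoPath {n}.

(* A negative cycle that no s-t walk can reach is invisible to s-t walk
   comparisons and does not affect s-t paths, so its presence does not forbid
   answering with a shortest path. If a negative cycle meets some s-t walk, the
   answer has to be a negative cycle. *)
Definition solves (R : realType) n (e : rel 'I_n) (w : 'I_n -> 'I_n -> R)
    (s t : 'I_n) (out : outcome n) : Prop :=
  match out with
  | NoPath => forall p, ~~ st_path e s t p
  | ShortestPath p =>
      [/\ st_path e s t p,
          forall q, st_path e s t q -> walk_length w p <= walk_length w q
        & forall c v, negative_cycle e w c -> v \in c ->
            ~~ (connect e s v && connect e v t)]
  | NegativeCycle c => negative_cycle e w c
  end.

Local Open Scope nat_scope.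

(* The machine is a unit-cost RAM with structured control flow. A program uses
   finitely many registers and finitely many unbounded arrays; both hold natural
   numbers. Arithmetic is limited to successor and predecessor, so every value
   is at most n plus a constant plus the running time (a word of O(log n) bits
   for polynomial running times). The graph is accessible through constant-time
   adjacency tests, the edge lengths only through Compare. *)

Inductive expr :=
  | Const of nat
  | Reg of nat
  | Fetch of nat & expr              (* array, index *)
  | Succ of expr
  | Pred of expr
  | Less of expr & expr
  | Equal of expr & expr
  | Adjacent of expr & expr.

Inductive cmd :=
  | Skip
  | Assign of nat & expr
  | Store of nat & expr & expr       (* array, index, value *)
  | Seq of cmd & cmd
  | If of expr & cmd & cmd           (* a test succeeds when it is nonzero *)
  | While of expr & cmd
  | Compare of nat & expr & expr.    (* result register, two list addresses *)

Record state := State { reg : nat -> nat; arr : nat -> nat -> nat }.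

Definition upd (T : Type) (f : nat -> T) (i : nat) (x : T) : nat -> T :=
  fun j => if j == i then x else f j.

Definition set_reg (st : state) (x v : nat) : state :=
  State (upd (reg st) x v) (arr st).

Definition set_arr (st : state) (a i v : nat) : state :=
  State (reg st) (upd (arr st) a (upd (arr st a) i v)).

(* Vertex sequences are null-terminated linked lists: the cell at address
   a != 0 has its vertex in array 0 and the address of the next cell in
   array 1. Lists may share cells. *)
Fixpoint vertex_list n (st : state) (a : nat) (p : seq 'I_n) : Prop :=
  if p is v :: q then
    [/\ a <> 0, arr st 0 a = v & vertex_list st (arr st 1 a) q]
  else a = 0.

Definition adjacent n (e : rel 'I_n) (i j : nat) : bool :=
  match (insub i : option 'I_n), (insub j : option 'I_n) with
  | Some u, Some v => e u v
  | _, _ => false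
  end.

Fixpoint eval n (e : rel 'I_n) (st : state) (E : expr) : nat :=
  match E with
  | Const k => k
  | Reg x => reg st x
  | Fetch a E1 => arr st a (eval e st E1)
  | Succ E1 => (eval e st E1).+1
  | Pred E1 => (eval e st E1).-1
  | Less E1 E2 => eval e st E1 < eval e st E2
  | Equal E1 E2 => eval e st E1 == eval e st E2
  | Adjacent E1 E2 => adjacent e (eval e st E1) (eval e st E2)
  end.

Fixpoint expr_cost (E : expr) : nat :=
  match E with
  | Const _ | Reg _ => 1
  | Fetch _ E1 | Succ E1 | Pred E1 => (expr_cost E1).+1
  | Less E1 E2 | Equal E1 E2 | Adjacent E1 E2 =>
      (expr_cost E1 + expr_cost E2).+1
  end.

Definition comparison_code (c : comparison) : nat :=
  match c with Lt => 0 | Eq => 1 | Gt => 2 end.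

(* exec e oracle c st st' T Q: started in st, the command c halts in st' after
   T time units, Q of which are oracle queries. Each query takes one time unit,
   on top of the evaluation of its arguments. The relation is deterministic, and
   an illegal query leaves the machine stuck. *)
Inductive exec n (e : rel 'I_n)
    (oracle : seq 'I_n -> seq 'I_n -> option comparison) :
    cmd -> state -> state -> nat -> nat -> Prop :=
  | ExecSkip st :
      exec e oracle Skip st st 1 0
  | ExecAssign st x E :
      exec e oracle (Assign x E) st
        (set_reg st x (eval e st E)) (expr_cost E).+1 0
  | ExecStore st a E1 E2 :
      exec e oracle (Store a E1 E2) st
        (set_arr st a (eval e st E1) (eval e st E2))
        (expr_cost E1 + expr_cost E2).+1 0
  | ExecSeq c1 c2 st st1 st2 T1 T2 Q1 Q2 :
      exec e oracle c1 st st1 T1 Q1 ->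
      exec e oracle c2 st1 st2 T2 Q2 ->
      exec e oracle (Seq c1 c2) st st2 (T1 + T2) (Q1 + Q2)
  | ExecIf E c1 c2 st st' T Q :
      exec e oracle (if eval e st E != 0 then c1 else c2) st st' T Q ->
      exec e oracle (If E c1 c2) st st' (expr_cost E + T).+1 Q
  | ExecWhileEnd E c st :
      eval e st E = 0 ->
      exec e oracle (While E c) st st (expr_cost E).+1 0
  | ExecWhileStep E c st st1 st2 T1 T2 Q1 Q2 :
      eval e st E <> 0 ->
      exec e oracle c st st1 T1 Q1 ->
      exec e oracle (While E c) st1 st2 T2 Q2 ->
      exec e oracle (While E c) st st2 (expr_cost E + T1 + T2).+1 (Q1 + Q2)
  | ExecCompare x E1 E2 st P Q r :
      vertex_list st (eval e st E1) P ->
      vertex_list st (eval e st E2) Q ->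
      oracle P Q = Some r ->
      exec e oracle (Compare x E1 E2) st
        (set_reg st x (comparison_code r))
        (expr_cost E1 + expr_cost E2).+1 1.

Definition initial_state n (s t : 'I_n) : state :=
  State (fun x => match x with 0 => n | 1 => s | 2 => t | _ => 0 end)
        (fun _ _ => 0).

(* Register 0 holds the kind of the answer, register 1 the address of the list
   of its vertices. *)
Definition returns n (st : state) (out : outcome n) : Prop :=
  match out with
  | NoPath => reg st 0 = 0
  | ShortestPath p => reg st 0 = 1 /\ vertex_list st (reg st 1) p
  | NegativeCycle c => reg st 0 = 2 /\ vertex_list st (reg st 1) c
  end.

(* Main.v *)
Require Import Defs.
From mathcomp Require Import all_boot all_order all_algebra.
From mathcomp Require Import reals zify.
Set Implicit Arguments.
Unset Strict Implicit.
Unset Printing Implicit Defensive.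
Import Order.TTheory GRing.Theory Num.Theory.

(* The program is the synchronous Bellman-Ford algorithm directed towards t.
   Prepending a fixed s-v path turns a comparison of v-t walks into one of s-t
   walks, and lists grow at the front, so extending a walk backwards takes
   constant time. After k rounds the walk kept for a vertex v reachable from s
   is lexicographically minimal for (length, number of vertices) among the v-t
   walks of at most k.+1 vertices. Hence removing any cycle from it makes it
   strictly longer: a repeated vertex exhibits a negative cycle. If round n
   still changes a walk, that walk has more than n vertices and repeats one; if
   not, the lengths form a potential and no relevant cycle is negative. *)

(** * Walks and relaxation *)

Section Walks.
Local Open Scope ring_scope.

(** The time bound leaves constant time, on average, for each of the about [n ^ 3] relaxations,
    whereas a query needs two complete s-t walks that may have linearly many vertices. Hence no walk
    is written out for a query: the v-t parts share the cells of earlier walks, and only the s-v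
    part is built anew. The two walks of a query part at v, and a cell has a single tail, so two
    copies of the s-v path are required. They are made once per vertex and round; their linear cost
    is spread over the n candidate edges at that vertex. The number of vertices is never computed or
    compared by the program. An update requires a strict gain in length, and on a tie the older walk
    survives, which is the one within the smaller vertex bound. This argument needs synchronous
    rounds: updates in place could produce walks with more vertices than the round allows. Vertices
    not reachable from s lie on no s-t walk, so nothing about them can be queried; every invariant
    is restricted to reachable vertices. *)

Lemma st_walk_consP n (e : rel 'I_n) (s t : 'I_n) (p : seq 'I_n) :
  st_walk e s t p -> exists2 q, p = s :: q & path e s q && (last s q == t).
Proof. by case: p => //= x q /and3P[/eqP-> pq lq]; exists q; rewrite ?pq. Qed.

Lemma st_walk_cons n (e : rel 'I_n) (t v u : 'I_n) (q : seq 'I_n) :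
  st_walk e v t (v :: u :: q) = e v u && st_walk e u t (u :: q).
Proof. by rewrite /= !eqxx /= andbA. Qed.

Lemma st_walk_cat n (e : rel 'I_n) (s t v : 'I_n) (p q : seq 'I_n) :
  st_walk e s t (p ++ v :: q) =
  st_walk e s v (rcons p v) && st_walk e v t (v :: q).
Proof.
case: p => [|x p] /=; last first.
  by rewrite cat_path last_cat last_rcons /= rcons_path !eqxx /= -!andbA.
by rewrite !eqxx andbT /=; case: eqP => // ->.
Qed.

Lemma walk_length_cons (R : realType) n (w : 'I_n -> 'I_n -> R) u v q :
  walk_length w (u :: v :: q) = w u v + walk_length w (v :: q).
Proof. by rewrite /walk_length /= big_cons. Qed.

Lemma walk_length1 (R : realType) n (w : 'I_n -> 'I_n -> R) u :
  walk_length w [:: u] = 0.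
Proof. by rewrite /walk_length big_nil. Qed.

Lemma walk_length_cat (R : realType) n (w : 'I_n -> 'I_n -> R) p v q :
  walk_length w (p ++ v :: q) =
  walk_length w (rcons p v) + walk_length w (v :: q).
Proof.
elim: p => [|x [|y p] IH] /=; first by rewrite walk_length1 add0r.
  by rewrite !walk_length_cons walk_length1 addr0.
by rewrite !walk_length_cons -addrA; congr (_ + _); apply: IH.
Qed.

(** [None] plays the part of an infinite length. The tie-break on the number of vertices excludes
    cycles of length zero as well as positive ones from the walk. *)
Definition lex_shortest (R : realType) n (e : rel 'I_n)
    (w : 'I_n -> 'I_n -> R) (t : 'I_n) (k : nat) (v : 'I_n)
    (o : option (seq 'I_n)) : Prop :=
  if o is Some p then
    [/\ st_walk e v t p, (size p <= k)%N &
     forall q, st_walk e v t q -> (size q <= k)%N ->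
       walk_length w p < walk_length w q \/
       walk_length w p = walk_length w q /\ (size p <= size q)%N]
  else forall q, st_walk e v t q -> (k < size q)%N.

Definition not_longer (R : realType) n (w : 'I_n -> 'I_n -> R)
    (o : option (seq 'I_n)) (q : seq 'I_n) : Prop :=
  if o is Some p then walk_length w p <= walk_length w q else False.

Definition strictly_shorter (R : realType) n (w : 'I_n -> 'I_n -> R)
    (o o' : option (seq 'I_n)) : Prop :=
  if o is Some p then
    if o' is Some q then walk_length w p < walk_length w q else True
  else False.

(* o is the outcome at v of relaxing the edges from v to the vertices of U. *)
Definition relaxed (R : realType) n (e : rel 'I_n) (w : 'I_n -> 'I_n -> R)
    (f : 'I_n -> option (seq 'I_n)) (v : 'I_n) (U : pred 'I_n)
    (o : option (seq 'I_n)) : Prop :=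
  [/\ o = f v \/ strictly_shorter w o (f v),
      forall u q, U u -> e v u -> f u = Some q -> not_longer w o (v :: q) &
      o = f v \/ exists u q, [/\ e v u, f u = Some q & o = Some (v :: q)]].

(** The triangle inequality d(v) <= w(v, u) + d(u) for the lengths of the kept walks, read as
    distances to t. *)
Definition potential (R : realType) n (e : rel 'I_n) (w : 'I_n -> 'I_n -> R)
    (s : 'I_n) (f : 'I_n -> option (seq 'I_n)) : Prop :=
  forall v u q, connect e s v -> e v u -> f u = Some q ->
    not_longer w (f v) (v :: q).

(** A walk with k.+1 vertices is an edge followed by a walk that some [f u] already beats. Against
    walks with at most k vertices, either the old walk is kept and was minimal, or the new one is
    strictly shorter, so its size does not matter. *)
Lemma relaxed_lex_shortest (R : realType) n (e : rel 'I_n)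
    (w : 'I_n -> 'I_n -> R) (s t : 'I_n) (k : nat) f v o :
  (forall u, connect e s u -> lex_shortest e w t k u (f u)) ->
  connect e s v -> (0 < k)%N -> relaxed e w f v predT o ->
  lex_shortest e w t k.+1 v o.
Proof.
move=> Hf sv k0 [H1 H2 H3].
have su u : e v u -> connect e s u.
  by move=> vu; apply: connect_trans sv (connect1 vu).
have Hv := Hf v sv.
(* A walk with exactly k.+1 vertices has a first edge because k is positive; its remainder falls
   under the minimality of [f u]. *)
have sz q : st_walk e v t q -> (k < size q)%N -> (size q <= k.+1)%N ->
   exists u q', [/\ q = v :: u :: q', e v u & exists2 p, f u = Some p
     & walk_length w p <= walk_length w (u :: q')].
  move=> wq; have [[|u q'] def_q /andP[pq lq]] := st_walk_consP wq.
    by rewrite def_q ltnNge k0.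
  rewrite def_q /= => k1 k2.
  move: pq lq => /=/andP[vu pq'] lq; exists u, q'; split=> //.
  have := Hf u (su u vu).
  have wuq : st_walk e u t (u :: q') by rewrite /= eqxx pq'.
  case: (f u) => [p [_ _ /(_ _ wuq k2)]|/(_ _ wuq)] /=;
    last by rewrite ltnNge -ltnS k2.
  by move=> Hp; exists p => //; case: Hp => [/ltW|[->]].
have wp p : o = Some p -> st_walk e v t p /\ (size p <= k.+1)%N.
  move=> def_o; case: H3 => [E|[u [q [vu fu]]]].
    by move: Hv; rewrite -E def_o => -[-> /leqW-> _].
  rewrite def_o => -[->]; have := Hf u (su u vu); rewrite fu => -[wq sq _].
  have [q' E _] := st_walk_consP wq.
  by rewrite E st_walk_cons vu -E wq.
case: o H1 H2 H3 wp => [p|] H1 H2 H3 wp; last first.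
  move=> q wq; rewrite leqNgt; apply/negP => sq.
  case: (leqP (size q) k) => [le_qk|gt_qk].
    by case: H1 => // E; move: Hv; rewrite -E => /(_ _ wq);
      rewrite ltnNge le_qk.
  have [//|u [q' [_ vu [p fu _]]]] := sz _ wq gt_qk.
  exact: (H2 u p isT vu fu).
have [wvp sp] := wp _ erefl; split=> // q wq sq.
case: (leqP (size q) k) => [le_qk|gt_qk].
  case: H1 => [E|]; first by move: Hv; rewrite -E => -[_ _ /(_ _ wq le_qk)].
  case: (f v) Hv => [p'|] /=; last by move=> /(_ _ wq); rewrite ltnNge le_qk.
  by move=> [_ _ /(_ _ wq le_qk)] [lt2|[<- _]] lt1; left => //;
    apply: lt_trans lt2.
have [//|u [q' [E vu [p' fu le_p']]]] := sz _ wq gt_qk.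
have := H2 u p' isT vu fu => /= le_p.
have wp' : st_walk e u t p' by have := Hf u (su u vu); rewrite fu => -[].
have {le_p'} le_p' : walk_length w (v :: p') <= walk_length w q.
  have [p'' Ep' _] := st_walk_consP wp'.
  by rewrite E Ep' !walk_length_cons lerD2l -Ep'.
have := le_trans le_p le_p'; rewrite le_eqVlt => /orP[/eqP->|]; last by left.
by right; split=> //; apply: leq_trans sp gt_qk.
Qed.

(** Anything that beats a minimum over walks with at most k vertices lies outside that range. So a
    change in a late round certifies a walk with many vertices. *)
Lemma strictly_shorter_size (R : realType) n (e : rel 'I_n)
    (w : 'I_n -> 'I_n -> R) (t : 'I_n) (k : nat) v o p :
  lex_shortest e w t k v o -> strictly_shorter w (Some p) o ->
  st_walk e v t p -> (k < size p)%N.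
Proof.
case: o => [q [_ _ Hq]|Hq] /= lt_pq wp; last exact: Hq.
rewrite ltnNge; apply/negP => sp.
case: (Hq _ wp sp) => [lt_qp|[E _]]; last by rewrite E ltxx in lt_pq.
by have := lt_trans lt_pq lt_qp; rewrite ltxx.
Qed.

(** Cutting out the part between the two visits of x leaves a competitor with fewer vertices, so
    minimality forces it to be strictly longer. *)
Lemma lex_shortest_cycle (R : realType) n (e : rel 'I_n)
    (w : 'I_n -> 'I_n -> R) (t : 'I_n) (k : nat) v a x b c :
  lex_shortest e w t k v (Some (a ++ x :: b ++ x :: c)) ->
  [/\ cycle e (x :: b), cycle_length w (x :: b) < 0 &
      st_walk e v x (rcons a x)].
Proof.
move=> [wp sp Hp].
move: (wp); rewrite st_walk_cat => /andP[wa].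
rewrite -cat_cons st_walk_cat => /andP[wb wc].
have pb : path e x (rcons b x) by move: wb => /and3P[].
split=> //.
have w2 : st_walk e v t (a ++ x :: c) by rewrite st_walk_cat wa.
have s2 : (size (a ++ x :: c) < size (a ++ x :: b ++ x :: c))%N.
  by rewrite !size_cat /= !size_cat /= ltn_add2l ltnS addnS ltnS leq_addl.
case: (Hp _ w2 (leq_trans (ltnW s2) sp)) => [|[_]]; last by rewrite leqNgt s2.
rewrite !(walk_length_cat _ a) -!cat_cons (walk_length_cat _ (x :: b)) ltrD2l.
by rewrite gtrDr.
Qed.

(** The triangle inequalities telescope along the path, and finiteness of [f] spreads backwards from
    its last vertex. On a closed path both ends carry the same walk, so the path has nonnegative
    length. *)
Lemma potential_path (R : realType) n (e : rel 'I_n) (w : 'I_n -> 'I_n -> R)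
    s f v q r :
  potential e w s f -> (forall u p, f u = Some p -> exists p', p = u :: p') ->
  connect e s v -> path e v q -> f (last v q) = Some r ->
  exists2 p, f v = Some p & walk_length w p <= walk_length w (v :: q) +
    walk_length w r.
Proof.
move=> Hf Hd; elim: q v => [|u q IH] v sv /=.
  by move=> _ fv; exists r => //; rewrite walk_length1 add0r.
move=> /andP[vu pq] fl.
have [p fu le_p] := IH u (connect_trans sv (connect1 vu)) pq fl.
have := Hf v u p sv vu fu; case: (f v) => //= p' le_p'; exists p' => //.
apply: le_trans le_p' _; have [p1 E] := Hd _ _ fu.
by rewrite E !walk_length_cons -addrA lerD2l -E.
Qed.

Lemma connect_short_walk n (e : rel 'I_n) u v :
  connect e u v -> exists2 p, st_walk e u v p & (size p <= n)%N.
Proof.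
move=> /connectP[p pp ->]; case: (shortenP pp) => p' pp' up' _.
exists (u :: p'); first by rewrite /= !eqxx pp'.
by rewrite -[leqRHS]card_ord -(card_uniqP up') max_card.
Qed.

Lemma solves_no_path (R : realType) n (e : rel 'I_n) (w : 'I_n -> 'I_n -> R)
    s t : lex_shortest e w t n.+1 s None -> solves e w s t NoPath.
Proof.
move=> Hs p; apply/negP => /andP[wp up].
have := Hs _ wp; rewrite ltnNge => /negP; apply; apply: leqW.
by rewrite -[leqRHS]card_ord -(card_uniqP up) max_card.
Qed.

Lemma solves_shortest_path (R : realType) n (e : rel 'I_n)
    (w : 'I_n -> 'I_n -> R) s t f p :
  (forall v, connect e s v -> lex_shortest e w t n.+1 v (f v)) ->
  (forall v, ~~ connect e s v -> f v = None) ->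
  potential e w s f -> f s = Some p -> solves e w s t (ShortestPath p).
Proof.
move=> Hf Hu Hpot fs.
have Hd u q : f u = Some q -> exists q', q = u :: q'.
  case: (boolP (connect e s u)) => [su|/Hu->//] fu.
  have := Hf u su; rewrite fu => -[/st_walk_consP[q' -> _] _ _].
  by exists q'.
(* Because v reaches t within n vertices, [f v] is not [None], and its length cancels from the
   telescoped inequality. *)
have noneg v q : connect e s v -> connect e v t -> path e v q -> last v q = v ->
    0 <= walk_length w (v :: q).
  move=> sv vt pq lq; have [r wr sr] := connect_short_walk vt.
  case fv : (f v) => [r'|]; last first.
    by have := Hf v sv; rewrite fv => /(_ _ wr); rewrite ltnNge (leqW sr).
  have := @potential_path _ _ _ w _ _ v q r' Hpot Hd sv pq; rewrite lq fv.
  by move=> /(_ erefl)[_ [<-]]; rewrite lerDr.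
have Hs := Hf s (connect0 _ _); rewrite fs in Hs.
have [wp sp Hp] := Hs.
have conn v q q' : st_walk e v t (q ++ v :: q') -> connect e v t.
  rewrite st_walk_cat => /andP[_] /= /and3P[_ pq /eqP <-].
  by apply/connectP; exists q'.
split.
- rewrite /st_path wp /=; apply/negPn/negP => /uniqPn.
  have x0 := s => /(_ x0)[i [j [lt_ij lt_j Eij]]].
  (* Cutting p at two positions of a repeated vertex yields the shape of [lex_shortest_cycle]; the
     negative cycle obtained contradicts [noneg]. *)
  have Ep : p = take i p ++ nth x0 p i :: (take (j - i.+1) (drop i.+1 p)) ++
      nth x0 p i :: drop j.+1 p.
    rewrite -{1}(cat_take_drop i p) (drop_nth x0); last exact: ltn_trans lt_j.
    congr (_ ++ _ :: _); rewrite -{1}(cat_take_drop (j - i.+1) (drop i.+1 p)).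
    by rewrite drop_drop subnK // (@drop_nth _ x0 j) // Eij.
  move: Hs; rewrite Ep => Hs.
  have [cc neg] := lex_shortest_cycle Hs.
  move=> wa.
  have si : connect e s (nth x0 p i).
    by have [q _ /andP[pq /eqP<-]] := st_walk_consP wa; apply/connectP;
      exists q.
  have it : connect e (nth x0 p i) t.
    move: Hs => [+ _ _]; rewrite st_walk_cat => /andP[_] /= /and3P[_ pq /eqP
      <-].
    by apply/connectP; eexists; last reflexivity.
  have := noneg _ (rcons (take (j - i.+1) (drop i.+1 p)) (nth x0 p i)) si it cc.
  by rewrite last_rcons => /(_ erefl); rewrite leNgt neg.
- move=> q /andP[wq uq].
  case: (Hp _ wq) => [|/ltW//|[->]//].
  by apply: leqW; rewrite -[leqRHS]card_ord -(card_uniqP uq) max_card.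
- move=> [//|y c] v [_ /andP[cc _] neg] vc; apply/negP => /andP[sv vt].
  have yc : y \in y :: c by rewrite mem_head.
  have sy := connect_trans sv (connect_cycle cc vc yc).
  have yt := connect_trans (connect_cycle cc yc vc) vt.
  have := noneg y (rcons c y) sy yt cc; rewrite last_rcons => /(_ erefl).
  by rewrite leNgt neg.
Qed.

End Walks.

(** * Total correctness with a time bound *)

(** The bound is syntactic, so cost analysis reduces to one semantic fact: no single execution of a
    loop makes more than N iterations. *)
Fixpoint time_bound (N : nat) (c : cmd) : nat :=
  match c with
  | Skip => 1
  | Assign _ E => (expr_cost E).+1
  | Store _ E1 E2 => (expr_cost E1 + expr_cost E2).+1
  | Seq c1 c2 => time_bound N c1 + time_bound N c2
  | If E c1 c2 => (expr_cost E + (time_bound N c1 + time_bound N c2)).+1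
  | While E c => N * (expr_cost E + time_bound N c).+1 + (expr_cost E).+1
  | Compare _ E1 E2 => (expr_cost E1 + expr_cost E2).+1
  end.

Fixpoint loop_depth (c : cmd) : nat :=
  match c with
  | Seq c1 c2 | If _ c1 c2 => maxn (loop_depth c1) (loop_depth c2)
  | While _ c => (loop_depth c).+1
  | _ => 0
  end.

(** In N this is a polynomial with nonnegative coefficients whose degree is the loop depth. For
    positive N it is at most the sum of the coefficients, its value at 1, times the leading
    power. *)
Lemma time_bound_poly N c d : 0 < N -> loop_depth c <= d ->
  time_bound N c <= time_bound 1 c * N ^ d.
Proof.
move=> N0; have P k : 0 < N ^ k by rewrite expn_gt0 N0.
elim: c d => [|x E|a E1 E2|c1 IH1 c2 IH2|E c1 IH1 c2 IH2|E c IH|x E1 E2] d /=;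
  try by move=> _; apply: leq_pmulr.
- by rewrite geq_max mulnDl => /andP[/IH1 h1 /IH2 h2]; apply: leq_add.
- rewrite geq_max => /andP[/IH1 h1 /IH2 h2].
  by have := P d; move: h1 h2; move: (N ^ d) => M; nia.
- case: d => // d; rewrite ltnS => /IH; rewrite expnS.
  by have := P d; move: (N ^ d) => M; nia.
Qed.

Definition runs n (e : rel 'I_n)
    (oracle : seq 'I_n -> seq 'I_n -> option comparison) (c : cmd)
    (st : state) (Post : state -> Prop) : Prop :=
  exists st' T Q,
    [/\ exec e oracle c st st' T Q, Q <= T, T <= time_bound n c & Post st'].

Section Rules.
Context (n : nat) (e : rel 'I_n).
Context (oracle : seq 'I_n -> seq 'I_n -> option comparison).
Implicit Types (st : state) (Post : state -> Prop).
Local Notation runs := (@runs n e oracle).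

Lemma runs_weaken c st (P P' : state -> Prop) :
  runs c st P -> (forall st', P st' -> P' st') -> runs c st P'.
Proof. by move=> [st' [T [Q [? ? ? HP]]]] PP'; exists st', T, Q; split=> //;
  apply: PP'. Qed.

Lemma runs_skip st Post : Post st -> runs Skip st Post.
Proof. by move=> H; exists st, 1, 0; split=> //; constructor. Qed.

Lemma runs_assign x E st Post :
  Post (set_reg st x (eval e st E)) -> runs (Assign x E) st Post.
Proof. by move=> H; do 3 eexists; split; [constructor|..]. Qed.

Lemma runs_store a E1 E2 st Post :
  Post (set_arr st a (eval e st E1) (eval e st E2)) ->
  runs (Store a E1 E2) st Post.
Proof. by move=> H; do 3 eexists; split; [constructor|..]. Qed.

Lemma runs_seq c1 c2 st Post :
  runs c1 st (fun st1 => runs c2 st1 Post) -> runs (Seq c1 c2) st Post.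
Proof.
move=> [st1 [T1 [Q1 [x1 q1 t1 [st2 [T2 [Q2 [x2 q2 t2 H]]]]]]]].
by do 3 eexists; split; [econstructor; eassumption|apply: leq_add..|].
Qed.

Lemma runs_if E c1 c2 st Post :
  (eval e st E <> 0 -> runs c1 st Post) ->
  (eval e st E = 0 -> runs c2 st Post) -> runs (If E c1 c2) st Post.
Proof.
move=> H1 H2.
have [st' [T [Q [x q t H]]]] : runs (if eval e st E != 0 then c1 else c2) st
  Post.
  by case: eqP.
do 3 eexists; split; [exact: ExecIf x| |..|exact: H]; first by lia.
by rewrite /=; move: t; case: ifP; lia.
Qed.

Lemma runs_compare x E1 E2 P Q r st Post :
  vertex_list st (eval e st E1) P -> vertex_list st (eval e st E2) Q ->
  oracle P Q = Some r -> Post (set_reg st x (comparison_code r)) ->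
  runs (Compare x E1 E2) st Post.
Proof.
move=> hP hQ hr H; do 3 eexists; split; [exact: ExecCompare hP hQ hr|..|exact:
  H];
 by rewrite /=; lia.
Qed.

(** The index of [I] bounds the iterations still allowed. At index 0 the equation [k = k'.+1] is
    impossible, so the test must fail. *)
Lemma runs_while (I : nat -> state -> Prop) m E c st Post :
  m <= n -> I m st ->
  (forall k st1, I k st1 -> eval e st1 E <> 0 ->
     exists2 k', k = k'.+1 & runs c st1 (I k')) ->
  (forall k st1, I k st1 -> eval e st1 E = 0 -> Post st1) ->
  runs (While E c) st Post.
Proof.
move=> le_mn Im step stop.
suff [st' [T [Q [x q t H]]]] : exists st' T Q, [/\ exec e oracle (While E c) st
  st' T Q,
    Q <= T, T <= m * (expr_cost E + time_bound n c).+1 + (expr_cost E).+1 &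
      Post st'].
  exists st', T, Q; split=> //; apply: leq_trans t _.
  by rewrite leq_add2r leq_mul2r le_mn orbT.
elim: m {le_mn} st Im => [|m IH] st Im; case: (eval e st E =P 0) => [E0|E1].
- by do 3 eexists; split; [exact: ExecWhileEnd|..|exact: stop Im E0].
- by have [k] := step _ _ Im E1.
- do 3 eexists; split; [exact: ExecWhileEnd| |..|exact: stop Im E0] => //.
  exact: leq_addl.
have [k [<-] [st1 [T1 [Q1 [x1 q1 t1 /IH]]]]] := step _ _ Im E1.
move=> [st2 [T2 [Q2 [x2 q2 t2 H]]]].
do 3 eexists; split; [exact: ExecWhileStep E1 x1 x2|by lia| |exact: H].
by rewrite mulSn; lia.
Qed.

Definition For (x : nat) (c : cmd) : cmd :=
  Seq (Assign x (Const 0))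
      (While (Less (Reg x) (Reg 0)) (Seq c (Assign x (Succ (Reg x))))).

Lemma runs_for (I : nat -> state -> Prop) x c st Post :
  x != 0 -> reg st 0 = n ->
  I 0 (set_reg st x 0) ->
  (forall (i : 'I_n) st1, I i st1 -> reg st1 x = i ->
     runs c st1 (fun st2 => [/\ reg st2 x = i, reg st2 0 = reg st1 0 &
       I i.+1 (set_reg st2 x i.+1)])) ->
  (forall st1, reg st1 0 = n -> I n st1 -> Post st1) ->
  runs (For x c) st Post.
Proof.
move=> x0 st0 I0 step stop; apply: runs_seq; apply: runs_assign => /=.
pose J k st1 := exists i, [/\ i + k = n, reg st1 x = i, reg st1 0 = n & I i
  st1].
apply: (@runs_while J n) => //.
- by exists 0; rewrite /= /upd eqxx eq_sym (negPf x0).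
- move=> k st1 [i [ik xi r0 Ii]] /=; rewrite xi r0.
  case: (ltnP i n) => // lt_in _; exists (n - i.+1); first by lia.
  apply: runs_seq; apply: runs_weaken (step (Ordinal lt_in) _ Ii xi) _.
  move=> st2 [xi2 r02 Ii2]; apply: runs_assign; rewrite /= xi2; exists i.+1.
  by split=> //=; rewrite ?/upd ?eqxx 1?eq_sym ?(negPf x0) ?r02 //; lia.
- move=> k st1 [i [ik xi r0 Ii]] /=; rewrite xi r0; case: (ltnP i n) => // ni _.
  by apply: stop => //; have <- : i = n by lia.
Qed.

End Rules.

(** * Linked lists and reachability from s *)

(** A list segment from [a] that stops at [b], so its end may be left open. Both bounds are strict:
    [lo] = 0 excludes the null address, and a positive [lo] excludes a mutable cell at [lo]; [hi] is
    usually the heap pointer, so later allocations cannot interfere. *)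
Fixpoint cells n (vertex next : nat -> nat) (lo hi a : nat) (p : seq 'I_n)
    (b : nat) : Prop :=
  if p is v :: q then
    [/\ lo < a < hi, vertex a = v & cells vertex next lo hi (next a) q b]
  else a = b.

Notation lseg st := (cells (arr st 0) (arr st 1)).

Lemma cells_frame n f g f' g' lo hi hi' a (p : seq 'I_n) b :
  hi <= hi' -> (forall i, lo < i < hi -> f' i = f i /\ g' i = g i) ->
  cells f g lo hi a p b -> cells f' g' lo hi' a p b.
Proof.
move=> le_hi same; elim: p a => //= v q IH a [a_in av aq].
have [-> ->] := same a a_in; split=> //; last exact: IH.
by case/andP: a_in => -> /leq_trans; apply.
Qed.

Lemma lseg_vertex_list n st lo hi a (p q : seq 'I_n) b :
  lseg st lo hi a p b -> vertex_list st b q -> vertex_list st a (p ++ q).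
Proof.
elim: p a => [|v p IH] a /=; first by move->.
by move=> [a_in av ap] bq; split=> //; [lia|apply: IH ap bq].
Qed.

Definition alloc (a : nat) (v tl : expr) : cmd :=
  Seq (Store 0 (Reg 3) v) (Seq (Store 1 (Reg 3) tl)
  (Seq (Store a v (Reg 3)) (Assign 3 (Succ (Reg 3))))).

(** The vertex is stored before [tl] is evaluated; the hypothesis on [tl] says that this store does
    not affect its value. *)
Lemma runs_alloc n (e : rel 'I_n) oracle a x tl st (Post : state -> Prop) :
  1 < a -> x != 3 ->
  (forall v, eval e (set_arr st 0 (reg st 3) v) tl = eval e st tl) ->
  (forall st',
     [/\ reg st' 3 = (reg st 3).+1, forall y, y <> 3 -> reg st' y = reg st y,
         forall i, arr st' 0 i = if i == reg st 3 then reg st x else arr st 0 i,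
         forall i, arr st' 1 i =
           if i == reg st 3 then eval e st tl else arr st 1 i &
         forall b i, 1 < b -> arr st' b i =
           if (b == a) && (i == reg st x) then reg st 3 else arr st b i] ->
     Post st') ->
  runs e oracle (alloc a (Reg x) tl) st Post.
Proof.
move=> a1 x3 tlE H.
do 3! [apply: runs_seq; apply: runs_store]; apply: runs_assign; apply: H.
have a0 : (0 == a) = false by lia.
have a1' : (1 == a) = false by lia.
split=> [|y y3|i|i|b i b1] /=; rewrite /upd /=.
- by [].
- by case: eqP.
- by rewrite a0.
- by rewrite a1' tlE.
- have b0 : (b == 0) = false by lia.
  have b1' : (b == 1) = false by lia.
  by case: eqP => [<-|_] /=; rewrite b0 b1'.
Qed.

(* Registers: 0, 1, 2 hold n, s, t; 3 is the first free heap address; 4, 5, 6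
   count the round, v and u. Array 2 holds for each reached v a list of the
   vertices of an s-v path in reverse order. *)
Definition reach_edge : cmd :=
  If (Fetch 2 (Reg 5)) Skip (If (Fetch 2 (Reg 6))
    (If (Adjacent (Reg 6) (Reg 5)) (alloc 2 (Reg 5) (Fetch 2 (Reg 6))) Skip)
    Skip).

(** The cubic budget allows n full scans of all pairs, which avoids a queue and leaves only counting
    loops. *)
Definition reach : cmd := For 4 (For 5 (For 6 reach_edge)).

(** Cells below the old heap pointer are frozen. Array 5 is included because cycle extraction must
    find it still zero. *)
Definition grows (st st' : state) : Prop :=
  [/\ reg st 3 <= reg st' 3,
      forall i, i < reg st 3 ->
        arr st' 0 i = arr st 0 i /\ arr st' 1 i = arr st 1 i,
      forall i, arr st' 5 i = arr st 5 i &
      [/\ reg st' 0 = reg st 0, reg st' 1 = reg st 1 & reg st' 2 = reg st 2]].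

Lemma grows_trans st1 st2 st3 : grows st1 st2 -> grows st2 st3 -> grows st1 st3.
Proof.
move=> [h12 s12 f12 [a b c]] [h23 s23 f23 [a' b' c']]; split.
- exact: leq_trans h12 h23.
- move=> i lt_i; have [-> ->] := s23 i (leq_trans lt_i h12); exact: s12.
- by move=> i; rewrite f23.
- by rewrite a' b' c'.
Qed.

Lemma grows_lseg n st st' lo a (p : seq 'I_n) b hi :
  grows st st' -> hi <= reg st 3 ->
  lseg st lo hi a p b -> lseg st' lo hi a p b.
Proof.
by move=> [_ same _ _] le_hi; apply: cells_frame => // i /andP[_ lt_i];
  apply: same; lia.
Qed.

Lemma lseg_widen n st lo a (p : seq 'I_n) b hi hi' :
  hi <= hi' -> lseg st lo hi a p b -> lseg st lo hi' a p b.
Proof. by move=> ?; apply: cells_frame. Qed.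

(** [uniq] limits the path to n vertices and thereby the loop that copies it to n iterations. *)
Definition prefix_at n (e : rel 'I_n) (s : 'I_n) (st : state) (v : 'I_n)
    (c : seq 'I_n) : Prop :=
  [/\ lseg st 0 (reg st 3) (arr st 2 v) (v :: c) 0, uniq (v :: c) &
      st_walk e s v (rev (v :: c))].

(** [st0] is the start of the search, [st1] the start of the current scan, and [done v u] says that
    the edge from u to v was examined in this scan. All vertices on a stored path are marked, so a
    newly marked vertex is not on the path that it extends. *)
Definition reach_state n (e : rel 'I_n) (s : 'I_n) (st0 st1 : state)
    (done : 'I_n -> 'I_n -> Prop) (st : state) : Prop :=
  [/\ [/\ grows st0 st, reg st 0 = n & 0 < reg st 3],
      forall i, arr st 3 i = arr st0 3 i,
      forall v : 'I_n, arr st 2 v <> 0 -> exists2 c, prefix_at e s st v c &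
        forall x, x \in c -> arr st 2 x <> 0,
      forall v : 'I_n, arr st1 2 v <> 0 -> arr st 2 v <> 0 &
      forall v u : 'I_n, done v u -> e u v -> arr st1 2 u <> 0 ->
        arr st 2 v <> 0].

Lemma adjacentE n (e : rel 'I_n) (u v : 'I_n) : adjacent e u v = e u v.
Proof. by rewrite /adjacent !valK. Qed.

Section Reach.
Context (n : nat) (e : rel 'I_n).
Context (oracle : seq 'I_n -> seq 'I_n -> option comparison) (s : 'I_n).

Lemma reach_edge_correct (st0 st1 st : state) done done' (u v : 'I_n) :
  reach_state e s st0 st1 done st -> reg st 5 = v -> reg st 6 = u ->
  (forall x y, done' x y -> done x y \/ x = v /\ y = u) ->
  runs e oracle reach_edge st (fun st' => reach_state e s st0 st1 done' st' /\
    [/\ reg st' 0 = reg st 0, reg st' 4 = reg st 4, reg st' 5 = v & reg st' 6 =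
      u]).
Proof.
move=> [[g rn h0] d3 sound mono Hd] r5 r6 Hdone.
have keep : (e u v -> arr st1 2 u <> 0 -> arr st 2 v <> 0) ->
    reach_state e s st0 st1 done' st.
  by move=> Huv; split=> // x y /Hdone[/Hd//|[-> ->]].
apply: runs_if => /=; rewrite r5 => v0; first by apply: runs_skip; split=> //;
  apply: keep.
apply: runs_if => /=; rewrite r6 => u0; last first.
  by apply: runs_skip; split=> //; apply: keep => _ /mono.
apply: runs_if => /=; rewrite r5 r6 adjacentE => euv; last first.
  by apply: runs_skip; split=> //; apply: keep => /negPf; case: (e u v) euv.
have {}euv : e u v by case: (e u v) euv.
apply: runs_alloc => // st' [A3 Ar A0 A1 Aa].
rewrite /= r6 in A1; rewrite r5 in A0.
have A2 i : arr st' 2 i = if i == v then reg st 3 else arr st 2 i.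
  by rewrite Aa // r5.
have {}Aa b i : 2 < b -> arr st' b i = arr st b i.
  by move=> b2; rewrite Aa ?(ltnW b2) // gtn_eqF.
have same i : i < reg st 3 ->
    arr st' 0 i = arr st 0 i /\ arr st' 1 i = arr st 1 i.
  by move=> lt_i; rewrite A0 A1 ltn_eqF.
have fr a (p : seq 'I_n) b :
    lseg st 0 (reg st 3) a p b -> lseg st' 0 (reg st 3).+1 a p b.
  by apply: cells_frame => // i /andP[_]; apply: same.
split; last by rewrite !Ar.
split.
- split; rewrite ?A3 ?Ar //; apply: grows_trans g _; split; rewrite ?A3 ?Ar //.
  by move=> i; rewrite Aa.
- by move=> i; rewrite Aa.
- move=> x; rewrite /prefix_at A2 A3; case: eqP => [/val_inj-> _|ne x0].
    have [c [lc uc wc] cin] := sound u u0; exists (u :: c).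
      split.
      + split; first by lia.
          by rewrite A0 eqxx.
        by rewrite A1 eqxx; apply: fr.
      + rewrite cons_uniq uc andbT; apply/negP;
          rewrite inE => /orP[/eqP E|/cin//].
        by rewrite -E in u0.
      + rewrite rev_cons rev_cons -cats1 -cats1 -catA st_walk_cat.
        by rewrite -rev_cons wc /= euv !eqxx.
    move=> y; rewrite A2; case: (_ == _); first by lia.
    by rewrite inE => /orP[/eqP->|/cin].
  have [c [lc uc wc] cin] := sound x x0; exists c; first by split=> //;
    apply: fr.
  by move=> y /cin; rewrite A2; case: (_ == _) => //; lia.
- by move=> x /mono; rewrite A2; case: eqP; lia.
- move=> x y /Hdone[xy|[-> _]] exy x1; rewrite A2 ?eqxx; last by lia.
  by case: eqP; [lia|move=> _; apply: Hd xy exy x1].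
Qed.

(** By induction on the last edge, k scans mark every end of a walk from s with at most k.+1
    vertices, so n scans are enough. *)
Lemma reach_correct (st : state) :
  reg st 0 = n -> 0 < reg st 3 ->
  arr st 2 s <> 0 -> (forall v : 'I_n, v != s -> arr st 2 v = 0) ->
  prefix_at e s st s [::] ->
  runs e oracle reach st (fun st' => [/\ grows st st',
    forall i, arr st' 3 i = arr st 3 i &
    forall v : 'I_n, if connect e s v then exists c, prefix_at e s st' v c
                     else arr st' 2 v = 0]).
Proof.
move=> rn h0 s0 ns0 ps.
pose I k st' := reach_state e s st st (fun _ _ => False) st' /\
  forall v p, st_walk e s v p -> size p <= k.+1 -> arr st' 2 v <> 0.
apply: (@runs_for _ _ _ I) => //.
- split=> //=.
    split=> // v v0; have -> : v = s by apply/eqP; apply/negPn/negP => /ns0.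
    by exists [::].
  by move=> v p /st_walk_consP[[|x q] -> /andP[_ /eqP/= <-]].
- move=> k st1 [[[g rn1 h1] d3 sound mono _] Hk] r4.
  pose J i st' := reach_state e s st st1 (fun v _ => v < i) st' /\ reg st' 4 =
    k.
  apply: (@runs_for _ _ _ J) => //.
  + move=> v st2 [K2 r42] r52.
    pose L j st' := [/\ reach_state e s st st1
      (fun x y => x < v \/ x = v /\ y < j) st', reg st' 4 = k & reg st' 5 = v].
    apply: (@runs_for _ _ _ L) => //.
    * by case: K2 => -[].
    * split=> //; case: K2 => [? ? ? ? Hd]; split=> // x y [/Hd Hy|[_ //]];
        exact: Hy.
    * move=> u st3 [K3 r43 r53] r63.
      apply: runs_weaken (reach_edge_correct K3 r53 r63 (done' := fun x y => x
        < v \/ x = v /\ y < u.+1) _) _.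
        move=> x y [lt|[->]]; first by left; left.
        rewrite ltnS leq_eqVlt => /orP[/eqP/val_inj->|lt]; first by right.
        by left; right.
      by move=> st4 [K4 [? ? ? ?]]; split=> //; split=> //; rewrite -?r43.
    * move=> st3 r03 [[[g3 ? ?] ? ? ? Hd] r43 r53]; split=> //=.
        by rewrite r03; case: K2 => -[].
      split=> //; split=> // x y lt_x; apply: Hd.
      move: lt_x; rewrite ltnS leq_eqVlt => /orP[/eqP/val_inj->|lt];
        last by left.
      by right.
  + move=> st2 r02 [[[g2 ? ?] d32 sound2 mono2 Hd] r42]; split=> //.
      by rewrite r02.
    split.
      by split=> // v /mono /mono2.
    move=> v p wp sp; change (arr st2 2 v <> 0).
    case/lastP: p wp sp => // p x wp; rewrite size_rcons ltnS => sp.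
    have Ex : x = v.
      by have [q E /andP[_ /eqP<-]] := st_walk_consP wp;
        rewrite -(last_cons s) -E last_rcons.
    rewrite {}Ex in wp.
    case/lastP: p wp sp => [wp _|p y].
      apply: mono2; apply: (Hk v [:: v]) => //.
    rewrite -cats1 -cats1 -catA st_walk_cat => /andP[wy] /= /and3P[_ /andP[yv
      _] _] sp.
    rewrite cats1 in sp; exact: (Hd _ _ (ltn_ord v) yv (Hk _ _ wy sp)).
- move=> st1 r01 [[[g ? ?] d3 sound _ _] Hn]; split=> // v;
    case: ifP => [sv|nsv].
    have [p wp sp] := connect_short_walk sv.
    have v0 := Hn v p wp (leqW sp).
    by have [c pc _] := sound v v0; exists c.
  apply/eqP/negPn/negP => /eqP/sound[c [_ _ wc] _]; move/negP: nsv; apply.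
  by have [q _ /andP[pq /eqP<-]] := st_walk_consP wc; apply/connectP; exists q.
Qed.

End Reach.

(** * Relaxation of the edges leaving a vertex *)

(** Pushing the reversed path cell by cell restores the order from s to v. The first cell allocated
    holds v and ends the copy; its null tail is patched later. *)
Definition copy_prefix (x : nat) : cmd :=
  Seq (Assign 8 (Fetch 2 (Reg 5))) (Seq (Assign x (Const 0))
  (While (Reg 8)
    (Seq (Store 0 (Reg 3) (Fetch 0 (Reg 8)))
    (Seq (Store 1 (Reg 3) (Reg x))
    (Seq (Assign x (Reg 3))
    (Seq (Assign 3 (Succ (Reg 3)))
         (Assign 8 (Fetch 1 (Reg 8))))))))).

Lemma copy_prefix_correct n (e : rel 'I_n) oracle x st (v : 'I_n) c :
  x = 9 \/ x = 10 -> 0 < reg st 3 -> reg st 5 = v -> uniq (v :: c) ->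
  lseg st 0 (reg st 3) (arr st 2 v) (v :: c) 0 ->
  runs e oracle (copy_prefix x) st (fun st' =>
    [/\ reg st 3 < reg st' 3,
        lseg st' (reg st 3) (reg st' 3) (reg st' x) (rev c) (reg st 3),
        arr st' 0 (reg st 3) = v,
        forall b i, b < 2 -> i < reg st 3 -> arr st' b i = arr st b i &
        (forall b i, 1 < b -> arr st' b i = arr st b i) /\
        (forall y, y <> 3 -> y <> 8 -> y <> x -> reg st' y = reg st y)]).
Proof.
move=> x910 h0 r5 uc lc; set h := reg st 3 in h0 lc *.
apply: runs_seq; apply: runs_assign; apply: runs_seq; apply: runs_assign => /=.
(* Here d is copied and r remains. The head of d is v, in cell h; the segment stops at h and says
   nothing about the tail of that cell. *)
pose I k st' := exists d r,
 [/\ v :: c = d ++ r, size r = k, lseg st' 0 h (reg st' 8) r 0,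
     if d is _ :: d' then [/\ h < reg st' 3,
        lseg st' h (reg st' 3) (reg st' x) (rev d') h & arr st' 0 h = v]
     else reg st' x = 0 /\ reg st' 3 = h &
     [/\ forall b i, b < 2 -> i < h -> arr st' b i = arr st b i,
         forall b i, 1 < b -> arr st' b i = arr st b i &
         forall y, y <> 3 -> y <> 8 -> y <> x -> reg st' y = reg st y]].
have x3 : (3 == x) = false by case: x910 => ->.
have x8 : (8 == x) = false by case: x910 => ->.
have x3' : (x == 3) = false by case: x910 => ->.
have x8' : (x == 8) = false by case: x910 => ->.
apply: (@runs_while _ _ _ I (size (v :: c))).
- by rewrite -[leqRHS]card_ord -(card_uniqP uc) max_card.
- exists [::], (v :: c); rewrite /= /upd /= x3 x8 eqxx r5 /=; split=> //.
  by split=> // y ? /eqP/negPf-> /eqP/negPf->.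
- move=> k st1 [d [[|z r] [Ed Ek lr Hd [f01 f2 fr]]]] /= r8.
    by rewrite /= in lr.
  case: lr => z_in z_v lr; case: k Ek => // k [Ek]; exists k => //.
  do 2! [apply: runs_seq; apply: runs_store]; do 2! [apply: runs_seq;
    apply: runs_assign].
  apply: runs_assign; rewrite /= /upd /= ?x3 ?x8 ?x3' ?x8' /=.
  have h3 : h <= reg st1 3 by case: (d) Hd => [[_ ->]|? ? [/ltnW]].
  have ne : (reg st1 8 == reg st1 3) = false by lia.
  rewrite /upd ne in lr *.
  exists (rcons d z), r; rewrite /= /upd /= ?x3 ?x8 ?x3' ?x8' /= ?eqxx.
  have same i : i < reg st1 3 -> (i == reg st1 3) = false by lia.
  split=> //.
  + by rewrite cat_rcons.
  + move: lr; apply: cells_frame => // i /andP[_ lt_i].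
    by rewrite /= /upd /= same //; lia.
  + case: d Hd Ed => [|y d] /=; last first.
      move=> [lt_h ld hv] _; rewrite ltnS h3 (same _ lt_h) hv rev_rcons /= eqxx
        z_v.
      split=> //; split=> //; first by lia.
      move: ld; apply: cells_frame => // i /andP[_ lt_i].
      by rewrite /= /upd /= same.
    by move=> [rx r3] [Ez _]; rewrite r3 eqxx z_v Ez; split.
  + split.
    * move=> b i b2 lt_i; rewrite -(f01 b) //.
      by case: b b2 => [|[|//]] _ /=; rewrite same //; lia.
    * by move=> [|[|b]] i //= /f2.
    * move=> y y3 y8 yx; rewrite -fr //.
      by move/eqP/negPf: y3 => ->; move/eqP/negPf: y8 => ->;
        move/eqP/negPf: yx => ->.
- move=> k st1 [d [[|z r] [Ed Ek lr Hd [f01 f2 fr]]]] /= r8; last first.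
    by case: lr; lia.
  rewrite cats0 in Ed; rewrite -Ed in Hd; case: Hd => ? ? ?; split=> //.
Qed.

Lemma relaxed_skip (R : realType) n (e : rel 'I_n) (w : 'I_n -> 'I_n -> R) f v
    (U U' : pred 'I_n) (u : 'I_n) o :
  (forall x, U' x -> x = u \/ U x) ->
  (forall q, e v u -> f u = Some q -> not_longer w o (v :: q)) ->
  relaxed e w f v U o -> relaxed e w f v U' o.
Proof.
move=> HU Hu [H1 H2 H3]; split=> // x q /HU[->|Ux] vx fx; first exact: Hu.
exact: H2 Ux vx fx.
Qed.

Lemma relaxed_update (R : realType) n (e : rel 'I_n) (w : 'I_n -> 'I_n -> R) f v
    (U U' : pred 'I_n) (u : 'I_n) o q :
  (forall x, U' x -> x = u \/ U x) -> e v u -> f u = Some q ->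
  strictly_shorter w (Some (v :: q)) o ->
  relaxed e w f v U o -> relaxed e w f v U' (Some (v :: q)) /\
    strictly_shorter w (Some (v :: q)) (f v).
Proof.
move=> HU vu fu lt_o [H1 H2 H3].
have lt_f : strictly_shorter w (Some (v :: q)) (f v).
  case: H1 => [<-//|]; case: o lt_o {H2 H3} => [p|] //=.
  by case: (f v) => //= p' lt1 lt2; apply: lt_trans lt2.
split=> //; split; [by right| |by right; exists u, q].
move=> x r /HU[->|Ux] vx fx.
  by move: fx; rewrite fu => -[->]; rewrite /not_longer lexx.
have := H2 x r Ux vx fx; case: o lt_o {H1 H2 H3} => //= p lt1 le2.
exact: le_trans (ltW lt1) le2.
Qed.

(* Array 3 holds the current v-t walks (0 if none), array 4 those of the next
   round. Registers 9 and 10 hold two copies of an s-v path, whose last cells 13 and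
   14 have mutable tails: a comparison of v-t walks becomes one of s-t walks.
   Register 11 is the list of the best v-t walk so far, or 0; cell 14 continues
   in the same way. *)
Definition relax_edge : cmd :=
  Seq (Store 1 (Reg 13) (Fetch 3 (Reg 6)))
  (Seq (Assign 12 (Const 0))
  (Seq (If (Reg 11) (Compare 12 (Reg 9) (Reg 10)) Skip)
  (If (Reg 12) Skip
    (Seq (Store 1 (Reg 14) (Fetch 3 (Reg 6)))
    (Seq (Assign 11 (Reg 14)) (Assign 7 (Succ (Reg 5)))))))).

Definition try_edge : cmd :=
  If (Fetch 3 (Reg 6)) (If (Adjacent (Reg 5) (Reg 6)) relax_edge Skip) Skip.

(** Cell 14 also holds v, so the tail of the old walk makes the second copy end in that walk. If
    there is none, the value fetched is arbitrary, and the test of register 11 prevents a query. *)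
Definition relax_vertex : cmd :=
  Seq (Assign 13 (Reg 3)) (Seq (copy_prefix 9)
  (Seq (Assign 14 (Reg 3)) (Seq (copy_prefix 10)
  (Seq (Assign 11 (Fetch 3 (Reg 5))) (Seq (Store 1 (Reg 14) (Fetch 1 (Reg 11)))
  (Seq (For 6 try_edge) (Store 4 (Reg 5) (Reg 11)))))))).

Definition represents n (st : state) (hi a : nat) (o : option (seq 'I_n)) :
  Prop :=
  if o is Some p then lseg st 0 hi a p 0 else a = 0.

Section Relax.
Context (R : realType) (n : nat) (e : rel 'I_n) (w : 'I_n -> 'I_n -> R).
Context (s t : 'I_n).

(** Growth is measured from the state before the copies are allocated: their mutable last cells lie
    above that heap pointer. *)
Definition vertex_frame (v : 'I_n) (st0 st : state) : Prop :=
  [/\ grows st0 st, forall b i, 1 < b -> b < 4 -> arr st b i = arr st0 b i,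
      reg st 4 = reg st0 4 & reg st 5 = v].

Definition prefix_copies (v : 'I_n) (c : seq 'I_n) (h b : nat) (st : state) :
  Prop :=
  [/\ [/\ reg st 13 = h, reg st 14 = b & h < b < reg st 3],
      lseg st h b (reg st 9) (rev c) h, arr st 0 h = v,
      lseg st b (reg st 3) (reg st 10) (rev c) b & arr st 0 b = v].

(** Queries read the best walk through cell [b], the result is read through register 11. Before any
    improvement the latter is a cell of an earlier round, with the same vertex and tail as [b]. *)
Definition best_list (v : 'I_n) (h b : nat) (st : state)
    (o : option (seq 'I_n)) : Prop :=
  if o is Some p then
    exists q, [/\ p = v :: q, st_walk e v t p,
      reg st 11 = b \/
      [/\ 0 < reg st 11 < h, arr st 0 (reg st 11) = v &
          arr st 1 (reg st 11) = arr st 1 b] &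
      lseg st 0 h (arr st 1 b) q 0]
  else reg st 11 = 0.

Definition flag_spec (v : 'I_n) (r0 r : nat) (o o' : option (seq 'I_n)) : Prop
  :=
  r = r0 /\ o = o' \/ r = v.+1 /\ strictly_shorter w o o'.

Definition vertex_inv f (v : 'I_n) c (b : nat) (st0 : state) (U : pred 'I_n)
    (st : state) : Prop :=
  [/\ vertex_frame v st0 st, prefix_copies v c (reg st0 3) b st,
      forall a i, 3 < a -> arr st a i = arr st0 a i &
      exists o, [/\ relaxed e w f v U o,
        flag_spec v (reg st0 7) (reg st 7) o (f v) &
        best_list v (reg st0 3) b st o]].

Lemma prefix_copies_frame v c h b st st' :
  prefix_copies v c h b st ->
  (forall x, x <> 12 -> x <> 11 -> x <> 7 -> reg st' x = reg st x) ->
  (forall i, arr st' 0 i = arr st 0 i) ->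
  (forall i, i <> h -> i <> b -> arr st' 1 i = arr st 1 i) ->
  prefix_copies v c h b st'.
Proof.
move=> [[r13 r14 /andP[lt_hb lt_b]] lA vA lB vB] regs a0 a1.
split; rewrite ?a0 ?regs //.
- by rewrite lt_hb.
- by apply: cells_frame lA => // i ?; rewrite a0 a1 //; lia.
- by apply: cells_frame lB => // i ?; rewrite a0 a1 //; lia.
Qed.

(** The common prefix cancels. Code 0 is the strict case and the only one that leads to an
    update. *)
Lemma walk_comparison_prefix v p q q' :
  st_walk e s v (rcons p v) -> st_walk e v t (v :: q) -> st_walk e v t (v ::
    q') ->
  exists r, walk_comparison e w s t (p ++ v :: q) (p ++ v :: q') = Some r /\
   (if comparison_code r == 0
    then Order.lt (walk_length w (v :: q)) (walk_length w (v :: q'))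
    else Order.le (walk_length w (v :: q')) (walk_length w (v :: q))).
Proof.
move=> wp wq wq'; rewrite /walk_comparison !st_walk_cat wp wq wq' /=.
rewrite !walk_length_cat ltrD2l.
case: ltP => [lt|le]; first by exists Lt.
by case: eqP => _; [exists Eq|exists Gt].
Qed.

Lemma try_edge_correct f (v : 'I_n) c b st0 (U U' : pred 'I_n) (u : 'I_n) st :
  (forall u p, connect e s u -> f u = Some p -> st_walk e u t p) ->
  (forall u, connect e s u -> represents st0 (reg st0 3) (arr st0 3 u) (f u)) ->
  connect e s v -> st_walk e s v (rev (v :: c)) -> 0 < reg st0 3 ->
  vertex_inv f v c b st0 U st -> reg st 6 = u ->
  (forall x, U' x -> x = u \/ U x) ->
  runs e (walk_comparison e w s t) try_edge st (fun st' =>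
    [/\ reg st' 6 = u, reg st' 0 = reg st 0 & vertex_inv f v c b st0 U' st']).
Proof.
move=> fw fD sv wc h_gt0 [fr pc a4 [o [Ho flag best]]] r6 HU.
have [g d23 r4 r5] := fr.
have [grow same d5 [g0 g1 g2]] := g.
have d3 i : arr st 3 i = arr st0 3 i by rewrite d23.
have skip : (forall q, e v u -> f u = Some q -> not_longer w o (v :: q)) ->
    vertex_inv f v c b st0 U' st.
  move=> Hu; split; [exact: fr|exact: pc|exact: a4|].
  by exists o; split; [exact: relaxed_skip Hu Ho|exact: flag|exact: best].
apply: runs_if => /=; rewrite r6 d3 => Du; last first.
  apply: runs_skip; split=> //; apply: skip => q vu fu.
  have su := connect_trans sv (connect1 vu).
  have := fD u su; rewrite fu /=; have [q' -> _] := st_walk_consP (fw _ _ su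
    fu).
  by rewrite /= Du => -[].
apply: runs_if => /=; rewrite r5 r6 adjacentE => vu; last first.
  by apply: runs_skip; split=> //; apply: skip => q; case: (e v u) vu.
have {}vu : e v u by case: (e v u) vu.
have su := connect_trans sv (connect1 vu).
have := fD u su; case fu : (f u) => [q|//] /= lu.
have wu := fw _ _ su fu.
have [q1 Eq1 _] := st_walk_consP wu.
have wvu : st_walk e v t (v :: q) by rewrite Eq1 st_walk_cons vu -Eq1 wu.
set h := reg st0 3 in h_gt0 lu pc best *.
have [[r13 r14 /andP[lt_hb lt_b]] lA vA lB vB] := pc.
apply: runs_seq; apply: runs_store; apply: runs_seq; apply: runs_assign.
rewrite /= r13 r6 d3.
set st1 := set_reg _ _ _.
have regs1 x : x <> 12 -> reg st1 x = reg st x.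
  by rewrite /st1 /= /upd => /eqP/negPf->.
have arr1 i : arr st1 1 i = if i == h then arr st0 3 u else arr st 1 i by [].
have arrs1 a i : a <> 1 -> arr st1 a i = arr st a i.
  by rewrite /st1 /= /upd => /eqP/negPf->.
have reg12 : reg st1 12 = 0 by [].
clearbody st1.
(* Whatever the outcome, treating an edge alters only registers 7, 11, 12 and the tails of cells h
   and b. *)
have frame st' : (forall x, x <> 12 -> x <> 11 -> x <> 7 -> reg st' x = reg st
  x) ->
    (forall a i, a <> 1 -> arr st' a i = arr st a i) ->
    (forall i, i <> h -> i <> b -> arr st' 1 i = arr st 1 i) ->
    [/\ vertex_frame v st0 st', prefix_copies v c h b st' &
     forall a i, 3 < a -> arr st' a i = arr st0 a i].
  move=> regs arrs arr1'; split.
  - split; [|by move=> a i a1 a4'; rewrite arrs ?d23 //;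
      lia|by rewrite regs|by rewrite regs].
    split; rewrite ?regs //.
      move=> i lt_i; rewrite arrs // arr1'; first exact: same.
      by rewrite /h; lia.
      by rewrite /h in lt_hb; lia.
    by move=> i; rewrite arrs.
  - by apply: (prefix_copies_frame pc) => // x; apply: arrs.
  - by move=> a i a3; rewrite arrs ?a4 //; lia.
(* The accepting branch is reached in two ways, with no walk known so far or after a successful
   query, and is verified once for both. *)
have update st2 : strictly_shorter w (Some (v :: q)) o ->
    (forall x, x <> 12 -> reg st2 x = reg st x) ->
    (forall a i, arr st2 a i = arr st1 a i) ->
    runs e (walk_comparison e w s t)
    (Seq (Store 1 (Reg 14) (Fetch 3 (Reg 6)))
       (Seq (Assign 11 (Reg 14)) (Assign 7 (Succ (Reg 5))))) st2
    (fun st' =>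
     [/\ reg st' 6 = u, reg st' 0 = reg st 0 & vertex_inv f v c b st0 U' st']).
  move=> lt_o regs2 arrs2.
  apply: runs_seq; apply: runs_store; apply: runs_seq; apply: runs_assign.
  apply: runs_assign; rewrite /= /upd /= !regs2 // r6 r14 r5 arrs2 arrs1 // d3.
  set st3 := set_reg _ _ _.
  have regs3 x : x <> 12 -> x <> 11 -> x <> 7 -> reg st3 x = reg st x.
    move=> x12 x11 x7; rewrite /st3 /= /upd.
    by move/eqP/negPf: x11 => ->; move/eqP/negPf: x7 => ->; rewrite regs2.
  have arr3 i : arr st3 1 i = if (i == h) || (i == b) then arr st0 3 u else arr
    st 1 i.
    rewrite /st3 /= /upd /=; case: eqP => [->|_]; first by rewrite orbT.
    by rewrite arrs2 arr1 orbF.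
  have arrs3 a i : a <> 1 -> arr st3 a i = arr st a i.
    by move=> a1; rewrite /st3 /= /upd; move/eqP/negPf: (a1) => ->;
      rewrite arrs2 arrs1.
  have r11 : reg st3 11 = b by [].
  have r7 : reg st3 7 = v.+1 by [].
  clearbody st3.
  have [|//||F1 F2 F3] := frame st3; first exact: regs3.
    by move=> i ih ib; rewrite arr3; move/eqP/negPf: ih => ->;
      move/eqP/negPf: ib => ->.
  have [Hn flagn] := relaxed_update HU vu fu lt_o Ho.
  split; rewrite ?regs3 //; split=> //.
  exists (Some (v :: q)); split=> //; first by right.
  exists q; split=> //; first by left.
  rewrite arr3 eqxx orbT; apply: cells_frame lu => // i /andP[_ lt_i].
  rewrite arrs3 // arr3 (ltn_eqF lt_i) (ltn_eqF (ltn_trans lt_i lt_hb)).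
  exact: same.
(* Without a previous walk the query is skipped; register 12 keeps 0, the code of [Lt], so the edge
   is accepted. *)
case: o Ho flag best skip update => [p|] Ho flag best skip update; last first.
  apply: runs_seq; apply: runs_if => /=; rewrite regs1 // best // => _.
  apply: runs_skip; apply: runs_if => /=; rewrite reg12 // => _.
  by apply: update.
have [qp [Ep wp b11 lb]] := best; subst p.
have r11 : reg st 11 <> 0 by case: b11 => [->|[]]; lia.
have [F1 F2 F3] : [/\ vertex_frame v st0 st1, prefix_copies v c h b st1 &
     forall a i, 3 < a -> arr st1 a i = arr st0 a i].
  apply: frame => [x x12 _ _|a i a1|i /eqP/negPf ih _]; last by rewrite arr1 ih.
    exact: regs1.
  exact: arrs1.
have [[q13 q14 _] mA uA mB uB] := F2.
have Eh : (b == h) = false by lia.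
have samest1 i : i < h -> arr st1 0 i = arr st0 0 i /\ arr st1 1 i = arr st0 1
  i.
  by move=> lt_i; rewrite arrs1 // arr1 ltn_eqF //; apply: same.
apply: runs_seq; apply: runs_if => /=; rewrite regs1 // => _.
have wcv : st_walk e s v (rcons (rev c) v) by rewrite -rev_cons.
have [r [cmp Hr]] := walk_comparison_prefix wcv wvu wp.
apply: (runs_compare (P := rev c ++ v :: q) (Q := rev c ++ v :: qp) (r := r))
  => //=.
- apply: lseg_vertex_list mA _; split=> //; first by lia.
  rewrite arr1 eqxx -(cats0 q); apply: (@lseg_vertex_list _ _ 0 h _ _ _ 0) =>
    //.
  by apply: cells_frame lu => // i /andP[_ lt_i]; apply: samest1.
- apply: lseg_vertex_list mB _; split=> //; first by lia.
  rewrite arr1 Eh -(cats0 qp); apply: (@lseg_vertex_list _ _ 0 h _ _ _ 0) => //.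
  by apply: cells_frame lb => // i /andP[_ lt_i]; rewrite arrs1 // arr1 ltn_eqF.
apply: runs_if => /=; rewrite {1}/upd /= => code; last first.
  apply: update => //; first by rewrite code eqxx in Hr.
  by move=> x x12; rewrite /= /upd; move/eqP/negPf: (x12) => ->; apply: regs1.
apply: runs_skip.
have [G1 G2 G3] : let st2 := set_reg st1 12 (comparison_code r) in
    [/\ vertex_frame v st0 st2, prefix_copies v c h b st2 &
     forall a i, 3 < a -> arr st2 a i = arr st0 a i].
  apply: frame => [x x12 _ _|a i a1|i /eqP/negPf ih _];
    last by rewrite /= arr1 ih.
    by rewrite /= /upd; move/eqP/negPf: (x12) => ->; apply: regs1.
  exact: arrs1.
split; rewrite /= /upd /= ?regs1 //; split=> //.
exists (Some (v :: qp)); split.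
- apply: (relaxed_skip HU _ Ho) => r' _; rewrite fu => -[<-].
  by move/eqP/negPf: code Hr => ->.
- by rewrite /= /upd /= regs1.
- exists qp; split=> //; rewrite /= /upd /= ?regs1 //.
    case: b11 => [->|[lt11 v11 n11]]; [by left|right].
    split=> //; first by rewrite arrs1.
    by rewrite !arr1 Eh ltn_eqF //; case/andP: lt11.
  rewrite arr1 Eh; apply: cells_frame lb => // i /andP[_ lt_i].
  by rewrite /= arrs1 // arr1 ltn_eqF.
Qed.

End Relax.

(** * Rounds *)

(* Register 7 is 0 if the round has changed no walk, and v.+1 if it has changed
   the walk from v. *)
Definition relax_round : cmd :=
  Seq (Assign 7 (Const 0))
  (Seq (For 5 (If (Fetch 2 (Reg 5)) relax_vertex Skip))
       (For 5 (Store 3 (Reg 5) (Fetch 4 (Reg 5))))).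

Section Rounds.
Context (R : realType) (n : nat) (e : rel 'I_n) (w : 'I_n -> 'I_n -> R).
Context (s t : 'I_n).

Lemma relax_vertex_correct f (v : 'I_n) c st0 :
  (forall u p, connect e s u -> f u = Some p -> st_walk e u t p) ->
  (forall u, connect e s u -> represents st0 (reg st0 3) (arr st0 3 u) (f u)) ->
  connect e s v -> prefix_at e s st0 v c -> 0 < reg st0 3 -> reg st0 0 = n ->
  reg st0 5 = v ->
  runs e (walk_comparison e w s t) relax_vertex st0 (fun st' =>
    [/\ vertex_frame v st0 st',
        forall i : nat, i <> v -> arr st' 4 i = arr st0 4 i &
        exists o, [/\ relaxed e w f v predT o,
          flag_spec w v (reg st0 7) (reg st' 7) o (f v) &
          represents st' (reg st' 3) (arr st' 4 v) o]]).
Proof.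
move=> fw fD sv [lc uc wc] h0 r0 r5; set h := reg st0 3 in h0.
apply: runs_seq; apply: runs_assign => /=; apply: runs_seq.
apply: runs_weaken.
  by apply: (@copy_prefix_correct _ _ _ 9 _ v c);
    [left|exact: h0|exact: r5|exact: uc|exact: lc].
move=> st2; rewrite /= /upd /= -/h; move=> [lt_h2 lA vA old2 [arrs2 regs2]].
apply: runs_seq; apply: runs_assign => /=; apply: runs_seq.
set b := reg st2 3 in lt_h2 lA *.
apply: runs_weaken.
  apply: (@copy_prefix_correct _ _ _ 10 _ v c); [by right| | |exact: uc|].
  - by rewrite /= /upd /= -/b; lia.
  - by rewrite /= /upd /= regs2.
  - rewrite /= /upd /= arrs2 //; apply: cells_frame lc;
      first by rewrite -/h -/b; lia.
    by move=> i /andP[_ lt_i]; rewrite !old2.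
move=> st3; rewrite /= /upd /= -/b; move=> [lt_b3 lB vB old3 [arrs3 regs3]].
have Rg x : x <> 3 -> x <> 8 -> x <> 9 -> x <> 10 -> x <> 13 -> x <> 14 ->
    reg st3 x = reg st0 x.
  move=> x3 x8 x9 x10 x13 x14; rewrite regs3 //.
  by move/eqP/negPf: (x14) => ->; rewrite regs2 //; move/eqP/negPf: (x13) => ->.
have Ar a i : 1 < a -> arr st3 a i = arr st0 a i by move=> a1;
  rewrite arrs3 // arrs2.
have Old i : i < h -> arr st3 0 i = arr st0 0 i /\ arr st3 1 i = arr st0 1 i.
  by move=> lt_i; rewrite !old3 ?old2 //; lia.
have r9 : reg st3 9 = reg st2 9 by rewrite regs3.
have r13 : reg st3 13 = h by rewrite regs3 //= regs2.
have r14 : reg st3 14 = b by rewrite regs3.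
apply: runs_seq; apply: runs_assign; apply: runs_seq; apply: runs_store.
rewrite /= /upd /= r14 (Rg 5) // r5 Ar //.
set st4 := set_arr _ _ _ _.
have r4E x : x <> 11 -> reg st4 x = reg st3 x by move/eqP/negPf => H;
  rewrite /= /upd H.
have r11 : reg st4 11 = arr st0 3 v by [].
have a4E a i : a <> 1 -> arr st4 a i = arr st3 a i by move/eqP/negPf => H;
  rewrite /= /upd H.
have a41 i : arr st4 1 i = if i == b then arr st3 1 (arr st0 3 v) else arr st3
  1 i by [].
clearbody st4.
have Old4 i : i < h -> arr st4 0 i = arr st0 0 i /\ arr st4 1 i = arr st0 1 i.
  by move=> lt_i; rewrite a4E // a41 ltn_eqF ?(ltn_trans lt_i lt_h2) //;
    apply: Old.
have inv0 : vertex_inv e w t f v c b st0 pred0 st4.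
  split.
  - split; [|by move=> a i a1 _; rewrite a4E ?Ar //;
      lia|by rewrite r4E ?Rg|by rewrite r4E ?Rg].
    split; [by rewrite r4E // -/h; lia|exact: Old4|by move=> i;
      rewrite a4E ?Ar|].
    by rewrite !r4E ?Rg.
  - split; rewrite ?a4E //.
    + by split; rewrite !r4E // lt_h2.
    + rewrite r4E // r9; apply: cells_frame lA => // i /andP[h_i i_b].
      by rewrite a4E // a41 ltn_eqF // !old3.
    + by rewrite old3.
    + rewrite !r4E //; apply: cells_frame lB => // i /andP[b_i i_3].
      by rewrite a4E // a41 gtn_eqF.
  - by move=> a i a3; rewrite a4E ?Ar //; lia.
  - exists (f v); split; first by split; [left| |left].
      by left; rewrite r4E ?Rg.
    have := fD v sv; have := fw v ^~ sv; rewrite /best_list /represents.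
    case: (f v) => [p /(_ p erefl) wp|_ E]; last by rewrite r11.
    have [q Ep _] := st_walk_consP wp; rewrite Ep => -[D_in vD lD].
    exists q; split=> //; first by rewrite -Ep.
      right; rewrite r11; split=> //; first by have [-> //] := Old4 (arr st0 3
        v) (proj2 (andP D_in)).
      by rewrite !a41 eqxx ltn_eqF //; case/andP: D_in => _ D_in;
        apply: ltn_trans D_in lt_h2.
    rewrite a41 eqxx; have [_ ->] := Old (arr st0 3 v) (proj2 (andP D_in)).
    by apply: cells_frame lD => // i /andP[_]; apply: Old4.
apply: runs_seq.
pose I j st' := vertex_inv e w t f v c b st0 [pred x | val x < j] st'.
apply: (@runs_for _ _ _ I) => //.
- by rewrite r4E ?Rg.
- move=> u st5 I5 r6.
  apply: runs_weaken.
    apply: (@try_edge_correct R n e w s t f v c b st0 _ [pred x | val x < u.+1]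
      u st5) => //.
      exact: I5.
    move=> x /=; rewrite ltnS leq_eqVlt => /orP[/eqP/val_inj->|lt];
      first by left.
    by right.
  by move=> st6 [? ? ?].
move=> st5 r50 [[F5 d5 q4 q5] P5 A5 [o [O5 Fl5 B5]]].
apply: runs_store; rewrite /= q5; split.
- by split=> // a i a1 a4; rewrite /= /upd ltn_eqF // d5.
- by move=> i /eqP/negPf iv; rewrite /= /upd /= iv A5.
exists o; split=> //.
  case: O5 => [O1 O2 O3]; split=> // u q _; apply: O2.
  exact: ltn_ord.
rewrite /= /upd /= eqxx.
case: o B5 {O5 Fl5} => [p [q [-> wp b11 lq]]|//].
have [[_ _ /andP[lt_hb lt_b]] _ _ _ vb] := P5.
have lq' : lseg st5 0 (reg st5 3) (arr st5 1 b) q 0.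
  by apply: lseg_widen lq; lia.
case: b11 => [->|[lt11 v11 n11]] /=.
  by split=> //; apply/andP; split=> //; lia.
split; [by apply/andP; split; lia|exact: v11|].
by change (lseg st5 0 (reg st5 3) (arr st5 1 (reg st5 11)) q 0); rewrite n11.
Qed.

(** The last clause speaks of the latest round only, hence [0 < k]. For k = n its second alternative
    is a walk too large to avoid a repetition. *)
Definition round_inv (st0 : state) (k : nat) (st : state) : Prop :=
  [/\ grows st0 st, forall i, arr st 2 i = arr st0 2 i &
   exists f, [/\
     forall u, connect e s u -> represents st (reg st 3) (arr st 3 u) (f u),
     forall u, connect e s u -> lex_shortest e w t k.+1 u (f u),
     forall u, ~~ connect e s u -> f u = None &
     0 < k -> reg st 7 = 0 /\ potential e w s f \/
       exists (v : 'I_n) p, [/\ reg st 7 = v.+1, connect e s v, f v = Some p &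
         k < size p]]].

Lemma relax_round_correct st0 k st :
  reg st0 0 = n -> 0 < reg st0 3 ->
  (forall v : 'I_n, if connect e s v then exists c, prefix_at e s st0 v c
                    else arr st0 2 v = 0) ->
  round_inv st0 k st ->
  runs e (walk_comparison e w s t) relax_round st (fun st' =>
    reg st' 4 = reg st 4 /\ round_inv st0 k.+1 st').
Proof.
move=> r0 h0 pre [g0 a2 [f [fD fS fN _]]].
have [g3 _ _ [g00 _ _]] := g0.
have fw u p : connect e s u -> f u = Some p -> st_walk e u t p.
  by move=> su fu; have := fS u su; rewrite fu => -[].
apply: runs_seq; apply: runs_assign => /=; apply: runs_seq.
(* The new walks [g] are fixed for the vertices below i, while [f] still describes array 3. *)
pose V i st' := [/\ grows st st', forall b i, 1 < b -> b < 4 -> arr st' b i =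
  arr st b i,
  reg st' 4 = reg st 4 & exists g,
  [/\ forall x, ~~ connect e s x -> g x = None,
      forall x : 'I_n, x < i -> connect e s x -> relaxed e w f x predT (g x) /\
        represents st' (reg st' 3) (arr st' 4 x) (g x) &
      reg st' 7 = 0 /\ (forall x : 'I_n, x < i -> connect e s x -> g x = f x) \/
      exists v : 'I_n, [/\ connect e s v, v < i, reg st' 7 = v.+1 &
        strictly_shorter w (g v) (f v)]]].
apply: (@runs_for _ _ _ V) => //=.
- by rewrite -r0.
- by split=> //; exists (fun _ => None); split=> //; left.
- move=> v st1 [gr1 d1 r41 [g [gN gD flag]]] r51.
  have [h1 same1 _ [r01 _ _]] := gr1.
  have a21 i : arr st1 2 i = arr st0 2 i by rewrite d1.
  apply: runs_if => /=; rewrite r51 a21 => v2; last first.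
    have nsv : ~~ connect e s v.
      apply/negP => sv; have := pre v; rewrite sv => -[c [lc _ _]].
      by move: lc; rewrite /= v2 => -[].
    apply: runs_skip; split=> //; split=> //; exists g; split=> //.
      move=> x; rewrite ltnS leq_eqVlt => /orP[/eqP/val_inj->|lt];
        last exact: gD.
      by rewrite (negPf nsv).
    case: flag => [[q7 gf]|[x [? ? ? ?]]]; last first.
      by right; exists x; split=> //; apply: leqW.
    left; split=> // x; rewrite ltnS leq_eqVlt => /orP[/eqP/val_inj->|lt];
      last exact: gf.
    by rewrite (negPf nsv).
  have [c [lc uc wc]] : exists c, prefix_at e s st0 v c.
    by have := pre v; case: ifP.
  have sv : connect e s v by have := pre v; case: ifP => // _ v0;
    rewrite v0 in v2.
  have gr01 := grows_trans g0 gr1.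
  have [h01 same01 _ _] := gr01.
  apply: runs_weaken.
    apply: (@relax_vertex_correct f v c st1) => //.
    + move=> u su; have := fD u su; rewrite d1 //; case: (f u) => //= p.
      by move/(grows_lseg gr1 (leqnn _)); apply: lseg_widen.
    + split=> //; rewrite a21; move/(grows_lseg gr01 (leqnn _)): lc.
      exact: lseg_widen.
    + exact: leq_trans h01.
    + by rewrite r01 g00.
  move=> st2 [[gr2 d2 r42 r52] a42 [o [O2 F2 D2]]].
  have [h2 same2 _ [r02 _ _]] := gr2.
  split=> //; split.
  - exact: grows_trans gr1 gr2.
  - by move=> b i b1 b4; rewrite /= d2 ?d1.
  - by rewrite -r41 -r42.
  exists (fun x => if x == v then o else g x); split.
  - by move=> x nsx; case: eqP => [E|_];
      [rewrite -E (negPf nsx) in sv|apply: gN].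
  - move=> x; rewrite ltnS leq_eqVlt => /orP[/eqP/val_inj-> _|lt sx].
      by rewrite eqxx.
    have xv : (x == v) = false by rewrite -val_eqE /=; lia.
    have [Ox Dx] := gD x lt sx; rewrite xv; split=> //.
    rewrite /= a42; last by lia.
    case: (g x) Dx => //= p; move/(grows_lseg gr2 (leqnn _)); exact: lseg_widen.
  - case: F2 => [[q7 Eo]|[q7 lt_o]].
      case: flag => [[p7 gf]|[x [sx lt_x x7 lt_g]]]; last first.
        right; exists x; rewrite ifN; last by rewrite -val_eqE /=; lia.
        by split=> //=; [apply: leqW|rewrite /= -x7 -q7].
      left; rewrite /= /upd /= q7 p7; split=> // x.
      rewrite ltnS leq_eqVlt => /orP[/eqP/val_inj-> _|lt];
        first by rewrite eqxx.
      by rewrite ifN; [apply: gf|rewrite -val_eqE /=; lia].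
    by right; exists v; rewrite eqxx; split.
move=> st1 r01 [gr1 d1 r41 [g [gN gD flag]]].
pose W i st' := [/\ grows st1 st', forall b i, b <> 3 -> arr st' b i = arr st1
  b i,
  reg st' 4 = reg st 4, reg st' 3 = reg st1 3 /\ reg st' 7 = reg st1 7 &
  forall x, x < i -> arr st' 3 x = arr st1 4 x].
apply: (@runs_for _ _ _ W) => //=.
- move=> v st2 [gr2 d2 r42 [r32 r72] c2] r52; apply: runs_store; rewrite /= r52.
  split=> //; split=> //.
    by move=> b i b3; rewrite /= /upd /=; move/eqP/negPf: (b3) => ->; apply: d2.
  move=> x; rewrite ltnS leq_eqVlt /= /upd /= => lt; case: eqP => [->|ne].
    exact: d2.
  by apply: c2; lia.
move=> st2 r02 [gr2 d2 r42 [r32 r72] c2]; split=> //.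
have gr02 := grows_trans g0 (grows_trans gr1 gr2).
split=> //; first by move=> i; rewrite d2 // d1.
have gS x : connect e s x -> lex_shortest e w t k.+2 x (g x).
  move=> sx; apply: (relaxed_lex_shortest (s := s) (f := f)) => //.
  by have [] := gD x (ltn_ord x) sx.
exists g; split=> // [u su|_].
  have [_] := gD u (ltn_ord u) su; rewrite c2 // r32.
  by case: (g u) => //= p; apply: cells_frame => // i _; rewrite !d2.
(* If nothing changed, then g = f and the relaxation inequalities are those of a potential.
   Otherwise a changed walk beats a minimum over at most k.+1 vertices. *)
rewrite r72; case: flag => [[q7 gf]|[v [sv _ q7 lt_g]]]; [left|right].
  split=> // v u q sv vu gu.
  have su := connect_trans sv (connect1 vu).
  have [[_ H2 _] _] := gD v (ltn_ord v) sv.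
  by apply: (H2 u q) => //; rewrite -gu gf.
exists v; case gv: (g v) lt_g => [p|] // lt_g; exists p; split=> //.
apply: strictly_shorter_size (fS v sv) lt_g _.
by have := gS v sv; rewrite gv => -[].
Qed.

End Rounds.

(** * Extracting the answer *)

(* Array 5 maps each visited vertex to its cell. The cycle closes at the first
   vertex met again, and cutting the last visited cell terminates its list. *)
Definition find_cycle : cmd :=
  Seq (Assign 8 (Fetch 3 (Pred (Reg 7))))
  (Seq (While (Equal (Fetch 5 (Fetch 0 (Reg 8))) (Const 0))
    (Seq (Store 5 (Fetch 0 (Reg 8)) (Reg 8))
    (Seq (Assign 15 (Reg 8)) (Assign 8 (Fetch 1 (Reg 8))))))
  (Seq (Store 1 (Reg 15) (Const 0))
  (Seq (Assign 1 (Fetch 5 (Fetch 0 (Reg 8)))) (Assign 0 (Const 2))))).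

(** The list may have more than n cells, but the visited vertices are distinct, so the loop stops
    within n iterations; it cannot run off the end because p has a repetition. *)
Lemma find_cycle_correct n (e : rel 'I_n) oracle st (v : 'I_n) h (p : seq 'I_n)
  :
  (forall i, arr st 5 i = 0) -> reg st 7 = v.+1 ->
  lseg st 0 h (arr st 3 v) p 0 -> ~~ uniq p ->
  runs e oracle find_cycle st (fun st' => exists a x b c,
    [/\ p = a ++ x :: b ++ x :: c, uniq (x :: b), reg st' 0 = 2 &
        vertex_list st' (reg st' 1) (x :: b)]).
Proof.
move=> a5 r7 lp nup.
apply: runs_seq; apply: runs_assign; rewrite /= r7 /=; apply: runs_seq.
(* The visited part d is recovered through array 5: each of its cells leads to the cell of the next
   visited vertex, the last one to register 8. *)
pose I k st' := exists d r,
 [/\ p = d ++ r /\ lseg st' 0 h (reg st' 8) r 0, size d + k = n, uniq d,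
  forall x : 'I_n, x \notin d -> arr st' 5 x = 0 &
  (forall a x b, d = a ++ x :: b ->
    [/\ arr st' 5 x <> 0, arr st' 0 (arr st' 5 x) = x &
        arr st' 1 (arr st' 5 x) = if b is y :: _ then arr st' 5 y else reg st'
          8]) /\
  (forall a z, d = rcons a z -> reg st' 15 = arr st' 5 z)].
have marked k st' : I k st' -> exists d x r,
   [/\ p = d ++ x :: r, 0 < reg st' 8, arr st' 0 (reg st' 8) = x,
       lseg st' 0 h (arr st' 1 (reg st' 8)) r 0 & (arr st' 5 x == 0) = (x
         \notin d)]
   /\ [/\ size d + k = n, uniq d,
  forall x : 'I_n, x \notin d -> arr st' 5 x = 0,
  forall a x b, d = a ++ x :: b ->
    [/\ arr st' 5 x <> 0, arr st' 0 (arr st' 5 x) = x &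
        arr st' 1 (arr st' 5 x) = if b is y :: _ then arr st' 5 y else reg st'
          8] &
  forall a z, d = rcons a z -> reg st' 15 = arr st' 5 z].
  move=> [d [[|x r] [[Ep lr] Ek ud n5 [nx ls]]]].
    by rewrite Ep cats0 ud in nup.
  exists d, x, r; split=> //; case: lr => in8 v8 lr; split=> //; first by lia.
  case: (boolP (x \in d)) => [xd|/n5-> //].
  by case/splitPr: xd nx => a b /(_ a x b erefl)[/eqP/negPf].
apply: (@runs_while _ _ _ I n) => //.
- exists [::], p; split=> //; first by move=> x _; apply: a5.
  by split=> [a x b|a z] /esym; [case: a|case: a].
- move=> k st1 /marked[d [x [r [[Ep r8 v8 lr m8] [Ek ud n5 nx ls]]]]].
  rewrite /= v8 m8; case: (boolP (x \in d)) => // xd _.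
  have udx : uniq (rcons d x) by rewrite rcons_uniq xd.
  have sz : size (rcons d x) <= n.
    by rewrite -[leqRHS]card_ord -(card_uniqP udx) max_card.
  rewrite size_rcons in sz; exists (n - size (rcons d x));
    first by rewrite size_rcons; lia.
  do 2! (apply: runs_seq; first [apply: runs_store|apply: runs_assign]).
  apply: runs_assign; rewrite /= /upd /= v8.
  exists (rcons d x), r; rewrite /= /upd /=; split=> //.
  + by rewrite cat_rcons.
  + by rewrite size_rcons; lia.
  + move=> y; rewrite mem_rcons inE negb_or => /andP[yx yd].
    by rewrite (negPf yx : (nat_of_ord y == x) = false) n5.
  split; last by move=> a z /rcons_inj[_ ->]; rewrite eqxx.
  move=> a y b; case/lastP: b => [|b z].
    by rewrite cats1 => /rcons_inj[_ <-]; rewrite eqxx; split=> //; lia.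
  rewrite -rcons_cons -rcons_cat => /rcons_inj[Ed <-].
  have [y0 vy ny] := nx _ _ _ Ed.
  have ne u : u \in d -> (nat_of_ord u == x) = false.
    by move=> ud'; apply/eqP => /val_inj E; rewrite E (negPf xd) in ud'.
  rewrite ne; last by rewrite Ed mem_cat mem_head orbT.
  split=> //; rewrite ny; case: b Ed {ny} => [|u b] Ed /=;
    first by rewrite eqxx.
  by rewrite ne // Ed mem_cat !inE eqxx !orbT.
- move=> k st1 /marked[d [x [r [[Ep r8 v8 lr m8] [Ek ud n5 nx ls]]]]].
  rewrite /= v8 m8; case: (boolP (x \in d)) => // xd _.
  apply: runs_seq; apply: runs_store; apply: runs_seq; apply: runs_assign.
  apply: runs_assign; rewrite /= /upd /= v8.
  set st' := set_reg _ _ _.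
  have suffix b a y : d = a ++ y :: b -> vertex_list st' (arr st1 5 y) (y :: b).
    elim: b a y => [|z b IH] a y Ed; have [y0 vy ny] := nx _ _ _ Ed.
      by split=> //=; rewrite /upd /= (ls a y) ?eqxx // Ed cats1.
    split=> //; rewrite /= /upd /=; case: eqP => [E|_]; last first.
      by rewrite ny; apply: (IH (rcons a y)); rewrite cat_rcons.
    (* If the cell of y were the one cut, y would be the last visited vertex, against [uniq d]. *)
    case/lastP: (z :: b) (isT : 0 < size (z :: b)) Ed {ny IH} => // c z' _ Ed.
    have E' := ls (a ++ y :: c) z'; rewrite rcons_cat rcons_cons in E'.
    have Ed' : d = (a ++ y :: c) ++ z' :: [::] by rewrite Ed -cats1 -catA.
    have [_ vz _] := nx _ _ _ Ed'.
    move: vy vz; rewrite E E' // => -> /val_inj yz.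
    move: ud; rewrite Ed cat_uniq cons_uniq mem_rcons inE yz eqxx.
    by case/and4P.
  case/splitPr: xd Ep ud suffix => a b Ep ud suffix.
  exists a, x, b, r; split=> //; first by rewrite Ep -catA.
    by move: ud; rewrite cat_uniq => /and3P[].
  exact: suffix erefl.
Qed.

Definition finish : cmd :=
  If (Reg 7) find_cycle
    (If (Fetch 3 (Reg 1))
       (Seq (Assign 1 (Fetch 3 (Reg 1))) (Assign 0 (Const 1)))
       (Assign 0 (Const 0))).

(** Address 0 is null, so the heap starts at 1. Cells 1 and 2 are the trivial path at s and the
    trivial walk at t. *)
Definition shortest_path_program : cmd :=
  Seq (Assign 3 (Const 1))
  (Seq (alloc 2 (Reg 1) (Const 0)) (Seq (alloc 3 (Reg 2) (Const 0))
  (Seq reach (Seq (For 4 relax_round) finish)))).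

(** * Correctness and cost of the whole program *)

Section Correctness.
Context (R : realType) (n : nat) (e : rel 'I_n) (w : 'I_n -> 'I_n -> R).
Context (s t : 'I_n).

Lemma finish_correct st0 st :
  (forall i, arr st0 5 i = 0) -> reg st0 1 = s ->
  round_inv e w s t st0 n st ->
  runs e (walk_comparison e w s t) finish st (fun st' =>
    exists2 out, returns st' out & solves e w s t out).
Proof.
move=> a5 r1 [[_ _ g5 [_ g1 _]] _ [f [fD fS fN flag]]].
have n0 : 0 < n by case: n s => [[]|].
apply: runs_if => /=.
  move=> q7; case: (flag n0) => [[//]|[v [p [r7 sv fv sz]]]].
  have Dv := fD v sv; have Sv := fS v sv; rewrite fv /= in Dv Sv.
  have nup : ~~ uniq p.
    apply/negP => up; move: sz.
    by rewrite ltnNge -[leqRHS]card_ord -(card_uniqP up) max_card.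
  apply: runs_weaken.
    by apply: (find_cycle_correct _ _ _ r7 Dv nup) => i; rewrite g5.
  move=> st' [a [x [b [c [Ep ub q0 lb]]]]].
  rewrite Ep in Sv; have [cyc neg _] := lex_shortest_cycle Sv.
  by exists (NegativeCycle (x :: b)); split=> //; apply/andP.
move=> q7; case: (flag n0) => [[_ pot]|[v [p [r7]]]]; last by rewrite r7 in q7.
have Ds := fD s (connect0 _ _); have Ss := fS s (connect0 _ _).
rewrite -r1 -g1 in Ds.
apply: runs_if => /= Ds0.
  apply: runs_seq; apply: runs_assign; apply: runs_assign => /=.
  case fs : (f s) Ds => [p|//] /= Dp; exists (ShortestPath p) => /=.
    split=> //; rewrite -(cats0 p).
    by apply: (@lseg_vertex_list _ _ 0 (reg st 3) _ _ _ 0); [exact: Dp|].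
  exact: (solves_shortest_path fS fN pot fs).
apply: runs_assign; exists NoPath => //; apply: solves_no_path.
case: (f s) Ds Ss => [p Dp [wp _ _]|//].
have [q E _] := st_walk_consP wp; move: Dp.
by rewrite E /= Ds0 => -[].
Qed.

Lemma shortest_path_program_correct :
  runs e (walk_comparison e w s t) shortest_path_program (initial_state s t)
    (fun st' => exists2 out, returns st' out & solves e w s t out).
Proof.
apply: runs_seq; apply: runs_assign.
apply: runs_seq; apply: runs_alloc => //= st1 [h1 rg1 v1 x1 o1].
apply: runs_seq; apply: runs_alloc => //= st2 [h2 rg2 v2 x2 o2].
rewrite /upd /= in h1 rg1 v1 x1 o1.
rewrite h1 in h2 v2 x2 o2; rewrite !rg1 //= in v2 x2 o2.
have rn : reg st2 0 = n by rewrite rg2 ?rg1.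
have rs : reg st2 1 = s by rewrite rg2 ?rg1.
have a2 i : arr st2 2 i = if i == s then 1 else 0 by rewrite o2 //= o1.
have a3 i : arr st2 3 i = if i == t then 2 else 0 by rewrite o2 //= o1.
have a5 i : arr st2 5 i = 0 by rewrite o2 //= o1.
apply: runs_seq; apply: runs_weaken.
  apply: (@reach_correct n e _ s st2) => //.
  - by rewrite h2.
  - by rewrite a2 eqxx.
  - by move=> v; rewrite a2 => /negPf vs; rewrite -val_eqE /= in vs; rewrite vs.
  - split=> //; last by rewrite /= !eqxx.
    by rewrite a2 eqxx h2 /= v2 x2 /= v1 x1 /=.
move=> st3 [gr3 a33 pre].
have [g3 same3 g35 [g30 g31 g32]] := gr3.
apply: runs_seq; apply: (@runs_for _ _ _ (round_inv e w s t st3)) => //.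
- by rewrite g30.
(* Before the first round only walks with one vertex count, and the only one that ends in t is
   [[:: t]]. *)
- split=> //; exists (fun u => if connect e s u && (u == t) then Some [:: t]
    else None).
  split=> //.
  + move=> u su; rewrite su /= a33 a3 -val_eqE /=; case: eqP => //= Eu.
    split; first by move: g3; rewrite h2.
      by rewrite (proj1 (same3 2 _)) ?h2 // v2.
    by rewrite (proj2 (same3 2 _)) ?h2 // x2.
  + move=> u su; rewrite su /=; case: eqP => [->|ne]; last first.
      move=> q /st_walk_consP[[|y q'] -> //] /= /eqP E.
      by case: ne.
    split=> //=; first by rewrite !eqxx.
    move=> q /st_walk_consP[[|y q'] -> //] _ _; right; split=> //.
  + by move=> u /negPf->.
- move=> k st4 inv4 r4.
  have [[_ _ _ [q0 _ _]] _ _] := inv4.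
  apply: runs_weaken.
    apply: (@relax_round_correct R n e w s t st3 k st4) => //.
    + by rewrite g30.
    + by apply: leq_trans g3; rewrite h2.
  move=> st5 [r5 inv5]; have [[_ _ _ [p0 _ _]] _ _] := inv5.
  by split; [rewrite r5|rewrite p0 q0|].
- move=> st4 _ inv4; apply: finish_correct inv4; last by rewrite g31.
  by move=> i; rewrite g35.
Qed.

End Correctness.

Theorem mainTheorem10 :
  exists (prog : cmd) (C : nat),
    forall (R : realType) (n : nat) (e : rel 'I_n) (w : 'I_n -> 'I_n -> R)
           (s t : 'I_n),
      exists (st : state) (T Q : nat) (out : outcome n),
        [/\ exec e (walk_comparison e w s t) prog (initial_state s t) st T Q,
            returns st out,
            solves e w s t out,
            Q <= C * n ^ 3
          & T <= C * n ^ 3].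
Proof.
(* Loops nest at most three deep: rounds, vertices, and either neighbours or cells of the prefix; in
   the search, scans and pairs. *)
exists shortest_path_program, (time_bound 1 shortest_path_program) => R n e w s
  t.
have [st [T [Q [run le_QT le_T [out ret sol]]]]] :=
  shortest_path_program_correct e w s t.
exists st, T, Q, out.
have {}le_T : T <= time_bound 1 shortest_path_program * n ^ 3.
  by apply: leq_trans le_T (time_bound_poly _ _) => //;
    case: n s {e w t st out run ret sol} => [[]|].
by split=> //; apply: leq_trans le_QT le_T.
Qed.
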